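(* Let $a,b$ be positive integers and let $\mathbb{T}_{a,b}$ be the infinite $(a,b)$--biregular tree. Let $p_0=\min\left(\frac{2a}{a+b},\frac{2b}{a+b}\right)$. Then: (a) for $t\geq 0$, $$p(\mathbb{T}_{a,b},t)=\frac{2abt+\frac{2ab}{a+b}-\frac{2ab}{a+b}\sqrt{1+(2a+2b-4)t+(a-b)^2t^2}}{2abt+2};$$ (b) for $0\leq p<p_0$, $$t(\mathbb{T}_{a,b},p)=\frac{a+b}{2ab}\cdot\frac{p\left(1-\frac{a+b}{2ab}p\right)}{\left(1-\frac{a+b}{2a}p\right)\left(1-\frac{a+b}{2b}p\right)};$$ (c) for $0\leq p\leq p_0$, $$\lambda_{\mathbb{T}_{a,b}}(p)=\frac{a}{a+b}H\left(\frac{a+b}{2a}p\right)+\frac{b}{a+b}H\left(\frac{a+b}{2b}p\right)+\frac12p\ln(ab)-\frac{ab}{a+b}H\left(\frac{a+b}{2ab}p\right).$$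
   Context: $H(q)=-(q\ln q+(1-q)\ln(1-q))$, $H(0)=H(1)=0$. For a finite graph $G$ with $m_k(G)$ matchings of size $k$ ($m_0=1$), let $M(G,t)=\sum_k m_k(G)t^k$, $p(G,t)=\frac{2t\,\frac{d}{dt}M(G,t)}{v(G)M(G,t)}$ for $t\geq 0$. Let $\nu(G)$ be the maximum matching size and $p^*(G)=2\nu(G)/v(G)$; $p(G,\cdot)$ is a strictly increasing bijection $[0,\infty)\to[0,p^*(G))$ with inverse $t(G,p)$. For $0\leq p<p^*(G)$ let $\lambda_G(p)=\frac{\ln M(G,t(G,p))}{v(G)}-\frac12p\ln t(G,p)$ (value $0$ at $p=0$), $\lambda_G(p^* )=\lim_{p\nearrow p^*}\lambda_G(p)$, $\lambda_G(p)=0$ for $p>p^*$. Let $(G_i)$ be any sequence of finite $(a,b)$--biregular bipartite graphs (one class of degree $a$, the other of degree $b$) with girth tending to infinity; then $p^*(G_i)=p_0$, and the limits $p(\mathbb{T}_{a,b},t)=\lim_ip(G_i,t)$ ($t\geq 0$), $t(\mathbb{T}_{a,b},p)=\lim_it(G_i,p)$ and $\lambda_{\mathbb{T}_{a,b}}(p)=\lim_i\lambda_{G_i}(p)$ ($0\leq p<p_0$) exist and are independent of the sequence; they define these functions, together with $\lambda_{\mathbb{T}_{a,b}}(p_0)=\lim_{p\nearrow p_0}\lambda_{\mathbb{T}_{a,b}}(p)$. *)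

(* Defs.v *)
From HB Require Import structures.
From mathcomp Require Import all_boot all_order all_algebra.
From mathcomp Require Import all_classical all_reals all_analysis.
Set Implicit Arguments. Unset Strict Implicit. Unset Printing Implicit Defensive.
Import Order.TTheory GRing.Theory Num.Theory.
Import numFieldNormedType.Exports.

Local Open Scope ring_scope.

Record FinGraph := FGraph { fg_n : nat; fg_adj : rel 'I_fg_n }.
Arguments fg_adj : clear implicits.

Definition nverts (G : FinGraph) : nat := fg_n G.

Definition edges (G : FinGraph) : {set {set 'I_(fg_n G)}} :=
  [set [set u; v] | u in 'I_(fg_n G), v in 'I_(fg_n G) & fg_adj G u v].

Definition is_matching (G : FinGraph) (M : {set {set 'I_(fg_n G)}}) : bool :=
  (M \subset edges G) && finset.trivIset M.

Definition nmatch (G : FinGraph) (k : nat) : nat :=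
  #|[set M : {set {set 'I_(fg_n G)}} | is_matching M & #|M| == k]|.

Definition numatch (G : FinGraph) : nat :=
  \max_(M : {set {set 'I_(fg_n G)}} | is_matching M) #|M|.

Section Real.
Variable R : realType.

Definition matchpoly (G : FinGraph) : {poly R} :=
  \poly_(k < (fg_n G).+1) (nmatch G k)%:R.

Definition pG (G : FinGraph) (t : R) : R :=
  2 * t * ((matchpoly G)^`()).[t] / ((nverts G)%:R * (matchpoly G).[t]).

Definition pstar (G : FinGraph) : R := 2 * (numatch G)%:R / (nverts G)%:R.

(* t(G,p): the inverse of p(G,.) : [0,oo) -> [0,p*(G)) *)
Definition tG (G : FinGraph) (p : R) : R := get [set t : R | 0 <= t /\ pG G t = p]%classic.

Definition lam0 (G : FinGraph) (p : R) : R :=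
  if p == 0 then 0
  else ln (matchpoly G).[tG G p] / (nverts G)%:R - 2^-1 * p * ln (tG G p).

(* full lambda_G: value at p* is the left limit; 0 beyond p*; (negative p: 0,
   never used) *)
Definition lamG (G : FinGraph) (p : R) : R :=
  if (0 <= p) && (p < pstar G) then lam0 G p
  else if p == pstar G then lim (lam0 G q @[q --> (pstar G)^'-])%classic
  else 0.

Definition Hent (q : R) : R :=
  if (q == 0) || (q == 1) then 0
  else - (q * ln q + (1 - q) * ln (1 - q)).

End Real.

Definition biregular (a b : nat) (G : FinGraph) : Prop :=
  (0 < fg_n G)%N /\
  (forall u v, fg_adj G u v = fg_adj G v u) /\
  (forall u, ~~ fg_adj G u u) /\
  exists A : {set 'I_(fg_n G)},
    (forall u v, fg_adj G u v -> (u \in A) != (v \in A)) /\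
    (forall u, u \in A -> #|[set v | fg_adj G u v]| = a) /\
    (forall u, u \notin A -> #|[set v | fg_adj G u v]| = b).

Definition girth_to_infty (G : nat -> FinGraph) : Prop :=
  forall g : nat, exists N : nat, forall i : nat, (N <= i)%N ->
    forall s : seq 'I_(fg_n (G i)),
      uniq s -> (3 <= size s)%N -> path.cycle (fg_adj (G i)) s -> (g <= size s)%N.

(* Main.v *)
Require Import Defs.
From HB Require Import structures.
From mathcomp Require Import all_boot all_order all_algebra.
From mathcomp Require Import all_classical all_reals all_analysis.
From mathcomp Require Import ring lra.
Import Order.TTheory GRing.Theory Num.Theory.
Import numFieldNormedType.Exports.

Local Open Scope ring_scope.

(* Let [r W v = Z (W \ v) / Z W], where [Z W] is the weight of the matchings
   inside a vertex set [W] at activity [t].  Expanding along the edges at [v],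
     r W v = 1 / (1 + t * sum of r (W \ v) u over the neighbours u of v in W),
   so in a graph of large girth [r] obeys, along a self-avoiding path, the
   recursion of the biregular tree; two steps of it contract the relative
   distance to its fixed point by a factor bounded away from 1, uniformly for
   bounded [t].
   Everything is rational in the probability [gam] that a given edge of the tree
   is matched: a vertex of degree [d] is covered with probability [d gam], hence
   [p = 2 a b gam / (a + b)], and
   [t = gam (1 - gam) / ((1 - a gam) (1 - b gam))]; (a) picks a root of this
   quadratic equation in [gam].  Monotonicity of [p (G, .)] transfers the
   convergence to its inverse, and [ln M (G, t) / v (G)] converges because its
   derivative [p (G, t) / (2 t)] does, uniformly; integrating along [gam] gives
   the Bethe free energy of the tree. *)

(** * Matchings *)

Section Matchings.
Variables (R : realType) (G : FinGraph) (t : R).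
Hypothesis adj_sym : forall u v, fg_adj G u v = fg_adj G v u.
Hypothesis adj_irr : forall u, ~~ fg_adj G u u.
Hypothesis t_ge0 : 0 <= t.

Local Notation V := 'I_(fg_n G).
Local Notation adj := (fg_adj G).

(** Deleting vertices only shrinks [W], so all partition functions stay over the one vertex type of
    [G] and no induced subgraph is formed. *)
Definition matchsum (W : {set V}) : R :=
  \sum_(M : {set {set V}} | is_matching M && (finset.cover M \subset W)) t ^+ #|M|.

Lemma edgesP (e : {set V}) :
  reflect (exists u v, adj u v /\ e = [set u; v]%SET) (e \in edges G).
Proof.
apply: (iffP imset2P) => [[u v _]|[u [v [uv ->]]]].
  by rewrite inE => uv ->; exists u, v.
by exists u v; rewrite ?inE.
Qed.

Lemma mem_edges u v : ([set u; v]%SET \in edges G) = adj u v.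
Proof.
apply/edgesP/idP => [[x [y [xy e]]]|uv]; last by exists u, v.
have xNy : x != y by apply: contraTneq xy => ->; exact: adj_irr.
have /finset.set2P xuv : x \in [set u; v]%SET by rewrite e !inE eqxx.
have /finset.set2P yuv : y \in [set u; v]%SET by rewrite e !inE eqxx orbT.
case: xuv yuv xNy xy => -> [] ->; rewrite ?eqxx //.
by rewrite adj_sym.
Qed.

Lemma card_edge (e : {set V}) : e \in edges G -> #|e| = 2%N.
Proof.
case/edgesP => u [v [uv ->]]; rewrite finset.cards2.
by rewrite (_ : u != v) //; apply: contraTneq uv => ->; exact: adj_irr.
Qed.

Lemma set0_notin_matching (M : {set {set V}}) : is_matching M -> (finset.set0 : {set V}) \notin M.
Proof.
case/andP => /fintype.subsetP sM _; apply/negP => /sM /card_edge.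
by rewrite finset.cards0.
Qed.

Lemma card_cover_matching (M : {set {set V}}) :
  is_matching M -> #|finset.cover M| = (2 * #|M|)%N.
Proof.
case/andP => /fintype.subsetP sM /eqP <-.
transitivity (\sum_(e in M) 2)%N; last by rewrite sum_nat_const mulnC.
by apply: eq_bigr => e eM; apply: card_edge; exact: sM.
Qed.

Lemma matching_partner (M : {set {set V}}) v u w : is_matching M ->
  [set v; u]%SET \in M -> [set v; w]%SET \in M -> u = w.
Proof.
case/andP => /fintype.subsetP sM /finset.trivIsetP tM Mu Mw.
have vNu : v != u.
  by have := sM _ Mu; rewrite mem_edges; apply: contraTneq => ->; exact: adj_irr.
have [e|ne] := eqVneq [set v; u]%SET [set v; w]%SET.
  have : u \in [set v; w]%SET by rewrite -e !inE eqxx orbT.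
  by rewrite !inE eq_sym (negPf vNu) => /eqP.
have /pred0P/(_ v) := tM _ _ Mu Mw ne.
by rewrite /= !inE eqxx.
Qed.

(** Written as a sum over possible partners, so that the matchings covering [v] can be sorted by the
    partner of [v] through an exchange of sums. *)
Lemma matching_partner_sum (M : {set {set V}}) v : is_matching M ->
  (\sum_(u : V | [set v; u]%SET \in M) 1)%N = (v \in finset.cover M).
Proof.
move=> mM; have /andP[/fintype.subsetP sM _] := mM.
case: (boolP (v \in _)) => [/finset.bigcupP[e Me ve]|nv].
  have /edgesP[x [y [xy exy]]] := sM _ Me.
  have [u eu] : exists u, e = [set v; u]%SET.
    by move: ve; rewrite exy => /finset.set2P[]->; [exists y|exists x; rewrite finset.setUC].
  rewrite (bigD1 u) -?eu //= big1 // => w /andP[Mw].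
  by rewrite (@matching_partner M v w u mM) ?eqxx // -eu.
rewrite big_pred0 // => u; apply: contraNF nv => Mu.
by apply/finset.bigcupP; exists [set v; u]%SET; rewrite // !inE eqxx.
Qed.

(* Removing the edge [vu] is a bijection from the matchings containing it onto
   the matchings that avoid both its ends. *)
Lemma matchsum_edge (W : {set V}) v u : v \in W -> u \in W -> adj v u ->
  \sum_(M : {set {set V}} | [&& is_matching M, finset.cover M \subset W
                            & [set v; u]%SET \in M]) t ^+ #|M|
  = t * matchsum (W :\ v :\ u).
Proof.
move=> vW uW vu; rewrite /matchsum big_distrr /=.
set e := [set v; u]%SET.
have e0 : e != finset.set0 by apply/finset.set0Pn; exists v; rewrite !inE eqxx.
have avoid (M : {set {set V}}) : finset.cover M \subset W :\ v :\ u ->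
    {in M, forall B : {set V}, [disjoint e & B]}.
  move=> /fintype.subsetP sM B MB; apply/pred0Pn => -[x /andP[/= xe xB]].
  have /sM : x \in finset.cover M by apply/finset.bigcupP; exists B.
  by move: xe; rewrite !inE; case/orP => /eqP ->; rewrite eqxx ?andbF.
have eM (M : {set {set V}}) : finset.cover M \subset W :\ v :\ u -> e \notin M.
  move=> sM; apply/negP => /(avoid M sM); rewrite -setI_eq0 finset.setIid.
  by rewrite (negPf e0).
rewrite (reindex_onto (fun M : {set {set V}} => e |: M)
                      (fun M : {set {set V}} => M :\ e)) /=; last first.
  by move=> M /and3P[_ _ Me]; exact: finset.setD1K.
apply: eq_big => [M|M /andP[_ /eqP Me]]; last first.
  by rewrite finset.cardsU1 (_ : e \notin M) ?exprS // -Me !inE eqxx.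
have coverU : finset.cover (e |: M) = e :|: finset.cover M.
  by rewrite /finset.cover finset.bigcup_setU finset.big_set1.
apply/idP/idP; last first.
  move=> /andP[mM sM]; have eNM := eM _ sM.
  rewrite finset.setU1K // eqxx andbT !inE eqxx andbT coverU finset.subUset.
  rewrite (fintype.subset_trans sM) ?andbT; last first.
    by rewrite (fintype.subset_trans _ (finset.subD1set W v)) // finset.subD1set.
  rewrite finset.subUset !finset.sub1set vW uW !andbT.
  have s0 := set0_notin_matching _ mM.
  case/andP: mM => sME tM.
  rewrite /is_matching finset.subUset finset.sub1set mem_edges vu sME /=.
  by have [] := finset.trivIsetU1 (avoid M sM) tM s0.
move=> /andP[/and3P[mM]]; rewrite coverU => sM _ /eqP Me.
have eNM : e \notin M by rewrite -Me !inE eqxx.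
case/andP: mM; rewrite finset.subUset => /andP[_ sME] tM.
apply/andP; split.
  by rewrite /is_matching sME (finset.trivIsetS _ tM) // finset.subsetUr.
have : [disjoint e & finset.cover M].
  rewrite -setI_eq0; apply/eqP/finset.setP => x; rewrite finset.in_set0; apply/negbTE.
  apply/negP => /finset.setIP[xe /finset.bigcupP[B MB xB]].
  have /finset.trivIsetP/(_ e B) := tM.
  rewrite !inE eqxx MB orbT => /(_ isT isT).
  have -> : e != B by apply: contraNneq eNM => ->.
  by move=> /(_ isT) /pred0P/(_ x); rewrite /= xe xB.
move=> dis; apply/fintype.subsetP => x xM; rewrite !inE.
have : x \notin e by apply: contraTN dis => xe; apply/pred0Pn; exists x; rewrite /= xe.
rewrite !inE negb_or => /andP[-> ->] /=.
by move: sM; rewrite finset.subUset => /andP[_ /fintype.subsetP]; exact.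
Qed.

Lemma matchsum_rec (W : {set V}) v : v \in W ->
  matchsum W = matchsum (W :\ v)
             + t * \sum_(u in W | adj v u) matchsum (W :\ v :\ u).
Proof.
move=> vW; rewrite {1}/matchsum (bigID (fun M => v \in finset.cover M)) /= addrC.
congr (_ + _).
  by apply: eq_bigl => M; rewrite finset.subsetD1 andbA.
(* A matching that covers [v] is counted once, through its unique partner, and any other one not at
   all. *)
transitivity (\sum_(M : {set {set V}} | is_matching M && (finset.cover M \subset W))
     \sum_(u : V | [set v; u]%SET \in M) t ^+ #|M|).
  rewrite [RHS](bigID (fun M => v \in finset.cover M)) /= [X in _ = _ + X]big1 ?addr0.
    apply: eq_bigr => M /andP[/andP[mM _] vM].
    by rewrite sumr_const -sum1_card matching_partner_sum // vM.
  move=> M /andP[/andP[mM _] vM].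
  by rewrite sumr_const -sum1_card matching_partner_sum // (negPf vM).
rewrite (exchange_big_dep (fun u => (u \in W) && adj v u)) /=; last first.
  move=> M u /andP[/andP[/fintype.subsetP sE _] /fintype.subsetP sW] Mu.
  rewrite -mem_edges sE // andbT sW //.
  by apply/finset.bigcupP; exists [set v; u]%SET; rewrite // !inE eqxx orbT.
rewrite big_distrr /=; apply: eq_bigr => u /andP[uW vu].
by rewrite -matchsum_edge //; apply: eq_bigl => M; rewrite andbA.
Qed.

Lemma matchsum_gt0 W : 0 < matchsum W.
Proof.
have m0 : is_matching (finset.set0 : {set {set V}}).
  rewrite /is_matching finset.sub0set /=; apply/finset.trivIsetP => A B.
  by rewrite inE.
rewrite /matchsum (bigD1 finset.set0) /=; last first.
  by rewrite m0 /finset.cover finset.big_set0 finset.sub0set.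
by rewrite finset.cards0 expr0 ltr_pwDl // sumr_ge0 // => M _; rewrite exprn_ge0.
Qed.

Lemma card_matching_le (M : {set {set V}}) : is_matching M -> (#|M| <= fg_n G)%N.
Proof.
move=> mM; have := max_card (mem (finset.cover M)).
rewrite card_ord card_cover_matching // => h; apply: leq_trans h.
by rewrite leq_pmull.
Qed.

(** Groups matchings by size; a general [f] serves both the polynomial and its derivative. *)
Lemma sum_matchings (f : nat -> R) :
  \sum_(k < (fg_n G).+1) (nmatch G k)%:R * f k
  = \sum_(M : {set {set V}} | is_matching M) f #|M|.
Proof.
transitivity (\sum_(k < (fg_n G).+1)
   \sum_(M : {set {set V}} | is_matching M && (#|M| == k)) f k).
  apply: eq_bigr => k _; rewrite sumr_const mulr_natl; congr (_ *+ _).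
  by apply: eq_card => M; rewrite !inE.
rewrite (exchange_big_dep (fun M : {set {set V}} => is_matching M)) /=; last first.
  by move=> k M _ /andP[].
apply: eq_bigr => M mM.
have cM : (#|M| < (fg_n G).+1)%N by rewrite ltnS card_matching_le.
rewrite (big_pred1 (Ordinal cM)) // => k /=.
by rewrite mM /= eq_sym.
Qed.

Lemma horner_matchpoly :
  (matchpoly R G).[t] = \sum_(M : {set {set V}} | is_matching M) t ^+ #|M|.
Proof. by rewrite horner_poly sum_matchings. Qed.

Lemma horner_matchpoly_matchsum : (matchpoly R G).[t] = matchsum [set: V]%SET.
Proof.
rewrite horner_matchpoly; apply: eq_bigl => M.
by rewrite finset.subsetT andbT.
Qed.

Lemma horner_deriv_matchpoly : t * (matchpoly R G)^`().[t] =
  \sum_(M : {set {set V}} | is_matching M) #|M|%:R * t ^+ #|M|.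
Proof.
rewrite -(sum_matchings (fun k => k%:R * t ^+ k)) /matchpoly poly_def.
rewrite (raddf_sum (@deriv R)) horner_sum big_distrr /=; apply: eq_bigr => -[[|k] /= _] _.
  by rewrite derivZ derivXn !hornerE /= !(mul0r, mulr0).
by rewrite derivZ derivXn hornerZ hornerMn hornerXn /= exprS -mulr_natl; ring.
Qed.

(** A matching [M] covers [2 * #|M|] vertices, so [pG G t] is the mean fraction of covered vertices
    in a random matching of weight [t ^+ #|M|]; linearity of expectation splits it over the
    vertices. *)
Lemma pGE : pG G t = (fg_n G)%:R^-1 * \sum_(v : V)
  (1 - matchsum ([set: V]%SET :\ v) / matchsum [set: V]%SET).
Proof.
rewrite /pG -[2 * t * _]mulrA horner_deriv_matchpoly horner_matchpoly_matchsum /nverts.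
set Z := matchsum [set: V]%SET.
have Z0 : Z != 0 by rewrite gt_eqF // matchsum_gt0.
rewrite invfM mulrC -mulrA; congr (_ * _).
have -> : \sum_(v : V) (1 - matchsum ([set: V]%SET :\ v) / Z)
   = Z^-1 * \sum_(v : V) (Z - matchsum ([set: V]%SET :\ v)).
  by rewrite big_distrr /=; apply: eq_bigr => v _; rewrite mulrBr mulVf // mulrC.
congr (_ * _).
transitivity (\sum_(v : V) \sum_(M : {set {set V}}
    | is_matching M && (v \in finset.cover M)) t ^+ #|M|); last first.
  apply: eq_bigr => v _; rewrite /Z /matchsum [in RHS](bigID (fun M => v \in finset.cover M)) /=.
  rewrite [X in _ + X - _](_ : _ = matchsum ([set: V]%SET :\ v)).
    rewrite addrK; apply: eq_bigl => M; first by rewrite finset.subsetT andbT.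
  by apply: eq_bigl => M; rewrite finset.subsetD1 andbA.
rewrite (exchange_big_dep (fun M : {set {set V}} => is_matching M)) /=; last first.
  by move=> v M _ /andP[].
rewrite big_distrr /=; apply: eq_bigr => M mM.
rewrite (eq_bigl (fun v => v \in finset.cover M)); last by move=> v; rewrite mM.
by rewrite sumr_const card_cover_matching // -[RHS]mulr_natl natrM mulrA.
Qed.

(** For [v] in [W], the probability that a random matching inside [W] leaves [v] uncovered
    (monomer-dimer model). *)
Definition avoid_ratio (W : {set V}) (v : V) : R := matchsum (W :\ v) / matchsum W.

Lemma avoid_ratio_rec (W : {set V}) v : v \in W ->
  avoid_ratio W v * (1 + t * \sum_(u in W | adj v u) avoid_ratio (W :\ v) u) = 1.
Proof.
move=> vW; rewrite /avoid_ratio.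
have Z0 W' : matchsum W' != 0 by rewrite gt_eqF // matchsum_gt0.
rewrite -big_distrl /= mulrAC.
apply: (canLR (mulfK _)) => //; rewrite mul1r [RHS](matchsum_rec _ _ vW).
by rewrite mulrDr mulr1; congr (_ + _); rewrite mulrCA; congr (_ * _); rewrite mulrC mulfVK.
Qed.

Lemma avoid_ratio_gt0 W v : 0 < avoid_ratio W v.
Proof. by rewrite divr_gt0 // matchsum_gt0. Qed.

Lemma avoid_ratio_le1 (W : {set V}) v : v \in W -> avoid_ratio W v <= 1.
Proof.
move=> vW; have := avoid_ratio_rec _ _ vW.
set S := \sum_(u in W | _) _ => <-; have r0 := avoid_ratio_gt0 W v.
have S0 : 0 <= S by apply: sumr_ge0 => u _; exact/ltW/avoid_ratio_gt0.
by apply: ler_peMr; [exact: ltW|rewrite lerDl mulr_ge0].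
Qed.

End Matchings.

(** * Cavity recursion in graphs of large girth *)

Section Cavity.
Variables (R : realType) (G : FinGraph) (t T : R) (D g : nat).
Hypothesis adj_sym : forall u v, fg_adj G u v = fg_adj G v u.
Hypothesis adj_irr : forall u, ~~ fg_adj G u u.
Hypothesis t_ge0 : 0 <= t.
Hypothesis t_le : t <= T.

Local Notation V := 'I_(fg_n G).
Local Notation adj := (fg_adj G).
Local Notation ratio := (avoid_ratio R G t).

Hypothesis deg_le : forall v, (#|[pred u | adj v u]| <= D)%N.
Hypothesis girth_ge : forall s : seq V,
  uniq s -> (3 <= size s)%N -> path.cycle adj s -> (g <= size s)%N.

(** A fixed point of the cavity recursion: [X v] must not depend on which neighbour [w] has been
    deleted. In a biregular graph it will depend only on the class of [v]. *)
Variable X : V -> R.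
Hypothesis X_gt0 : forall v, 0 < X v.
Hypothesis X_le1 : forall v, X v <= 1.
Hypothesis X_rec : forall v w, adj v w ->
  X v * (1 + t * \sum_(u | adj v u && (u != w)) X u) = 1.

(** If a neighbour of [v] other than [w] lay on the path, the edge back to [v] would close a cycle
    of at most [size s + 2] vertices, fewer than the girth bound allows. *)
Lemma path_neighbours v w s u : uniq [:: v, w & s] -> path.path adj v (w :: s) ->
  (size s + 2 < g)%N -> adj v u -> (u \in (~: [set x in w :: s])%SET) = (u != w).
Proof.
move=> us ps sg vu; rewrite !inE negb_or; have [//|uw /=] := eqVneq u w.
apply/negP => /splitPr us'; case: us' us ps sg => p1 p2 us ps sg.
suff : (g <= size [:: v, w & rcons p1 u])%N.
  rewrite leqNgt => /negP; apply; apply: leq_ltn_trans sg.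
  by rewrite /= size_rcons size_cat /= addn2 !ltnS addnS ltnS leq_addr.
have e : [:: v, w & p1 ++ u :: p2] = [:: v, w & rcons p1 u] ++ p2.
  by rewrite /= -cats1 -catA.
apply: girth_ge; first by move: us; rewrite e cat_uniq => /andP[].
  by rewrite /= size_rcons.
move: ps; rewrite -cat_rcons -cat_cons.
rewrite cat_path => /andP[ps _].
by rewrite /path.cycle rcons_path ps /= last_rcons adj_sym.
Qed.

(** This is [1 / x - 1 / r = t * (S' - S)] multiplied by [r * x]. *)
Lemma recursion_diff (r x S S' : R) : r * (1 + t * S) = 1 -> x * (1 + t * S') = 1 ->
  r - x = t * r * x * (S' - S).
Proof.
move=> hr hx.
transitivity (r * (x * (1 + t * S')) - x * (r * (1 + t * S))).
  by rewrite hr hx !mulr1.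
by ring.
Qed.

Lemma weight_ge0 (r x : R) : 0 < r -> 0 < x -> 0 <= t * r * x.
Proof. by move=> r0 x0; rewrite mulr_ge0 ?(ltW x0) // mulr_ge0 // ltW. Qed.

Lemma sum_neighbours_le (P : pred V) (F : V -> R) v : (forall u, 0 <= F u <= 1) ->
  \sum_(u | adj v u && P u) F u <= D%:R.
Proof.
move=> F01; apply: (@le_trans _ _ (\sum_(u | adj v u) 1)).
  rewrite big_mkcondr; apply: ler_sum => u _.
  by case: ifP => _ //; case/andP: (F01 u).
by rewrite sumr_const ler_nat; exact: deg_le.
Qed.

Local Notation K := (T * D%:R).

Let K_ge0 : 0 <= K. Proof. by rewrite mulr_ge0 // (le_trans t_ge0). Qed.

(** [K] bounds [t] times any neighbour sum of numbers in the unit interval. The lower bound on [X]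
    turns the trivial estimate [r <= 1] into a relative error, which starts the induction below. *)
Lemma X_lower v w : adj v w -> 1 <= (1 + K) * X v.
Proof.
move=> vw; rewrite -{1}(X_rec _ _ vw) mulrC ler_pM2r // lerD2l ler_pM //.
  by apply: sumr_ge0 => u _; exact/ltW.
by apply: sum_neighbours_le => u; rewrite X_le1 ltW.
Qed.

(* Bounding the relative error makes the two-step contraction factor
   independent of the degrees: [t * r v * \sum r u = 1 - r v]. *)
Lemma cavity_contraction j v w s : uniq [:: v, w & s] -> path.path adj v (w :: s) ->
  (size s + 2 + 2 * j < g)%N ->
  `|ratio (~: [set x in w :: s])%SET v - X v| <= (1 + K) * (K / (1 + K)) ^+ j * X v.
Proof.
have K1 : 0 < 1 + K by rewrite ltr_pwDl.
elim: j v w s => [|j IH] v w s us ps sg.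
  set W := (~: _)%SET.
  have vw : adj v w by case/andP: ps.
  have vW : v \in W by rewrite !inE; case/andP: us; rewrite inE.
  have r1 := avoid_ratio_le1 R G t adj_sym adj_irr t_ge0 W v vW.
  have r0 := avoid_ratio_gt0 R G t t_ge0 W v.
  rewrite expr0 mulr1; have := X_lower _ _ vw; have := X_gt0 v.
  have : 0 <= K * X v by rewrite mulr_ge0 // ltW.
  rewrite ler_norml; move: (ratio W v) r0 r1 (X v) (K) => r r0 r1 x k; lra.
set W := (~: _)%SET; set eps := (1 + K) * (K / (1 + K)) ^+ j.
have eps0 : 0 <= eps.
  by apply: mulr_ge0; [exact: ltW|rewrite exprn_ge0 // divr_ge0 // ltW].
have vw : adj v w by case/andP: ps.
have vW : v \in W by rewrite !inE; case/andP: us; rewrite inE.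
have nbr u : adj v u -> (u \in W) = (u != w).
  by apply: path_neighbours => //; apply: leq_ltn_trans sg; rewrite leq_addr.
have Rv := avoid_ratio_rec R G t adj_sym adj_irr t_ge0 W v vW.
have r0 := avoid_ratio_gt0 R G t t_ge0.
have Xv := X_rec v w vw.
have eqS (F : V -> R) : \sum_(u in W | adj v u) F u = \sum_(u | adj v u && (u != w)) F u.
  apply: eq_bigl => u; rewrite andbC; case vu : (adj v u) => //=; exact: nbr.
rewrite eqS in Rv.
(* Deleting [v] prolongs the removed self-avoiding path, so the next vertex is in the same
   situation. *)
have EW : W :\ v = (~: [set x in [:: v, w & s]])%SET.
  by apply/finset.setP => x; rewrite !inE ?negb_or ?negb_or ?andbA ?andbT ?orbF.
(* First of the two steps: the error at [u] is measured relative to the ratio itself, no longer to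
   [X u], so that the second step can sum it by the recursion for the ratio. *)
have step u : adj v u -> u != w ->
    `|ratio (W :\ v) u - X u| <= eps * ratio (W :\ v) u.
  move=> vu uw.
  have uW : u \in W :\ v.
    rewrite !inE; have := nbr u vu; rewrite uw !inE => ->.
    by rewrite andbT; apply: contraTneq vu => ->; exact: adj_irr.
  have us2 : uniq [:: u, v, w & s].
    by rewrite cons_uniq us andbT; move: uW; rewrite EW !inE.
  have ps2 : path.path adj u [:: v, w & s] by rewrite /= adj_sym vu.
  have nbr2 z : adj u z -> (z \in W :\ v) = (z != v).
    rewrite EW; apply: path_neighbours => //=; apply: leq_ltn_trans sg.
    by rewrite mulnS; rewrite -!addnA addSn -addnS leq_add2l leq_addr.
  have Ru := avoid_ratio_rec R G t adj_sym adj_irr t_ge0 (W :\ v) u uW.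
  have eqSu (F : V -> R) : \sum_(z in W :\ v | adj u z) F z
      = \sum_(z | adj u z && (z != v)) F z.
    apply: eq_bigl => z; rewrite andbC; case uz : (adj u z) => //=; exact: nbr2.
  rewrite eqSu in Ru.
  have uv : adj u v by rewrite adj_sym.
  have Xu := X_rec u v uv.
  rewrite (recursion_diff _ _ _ _ Ru Xu) normrM.
  rewrite ger0_norm; last exact: weight_ge0.
  rewrite -sumrB.
  have le1 : `|\sum_(z | adj u z && (z != v)) (X z - ratio (W :\ v :\ u) z)|
      <= eps * \sum_(z | adj u z && (z != v)) X z.
    rewrite big_distrr /=; apply: le_trans (ler_norm_sum _ _ _) _.
    apply: ler_sum => z /andP[uz zv]; rewrite distrC.
    have -> : W :\ v :\ u = (~: [set x in [:: u, v, w & s]])%SET.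
      by apply/finset.setP => x; rewrite EW !inE ?negb_or ?andbA ?andbT ?orbF.
    apply: IH => //=.
    - rewrite -[_ && _]/(uniq [:: z, u, v, w & s]) cons_uniq us2 andbT.
      have zN : z \notin [:: v, w & s].
        by have := nbr2 z uz; rewrite zv EW finset.in_setC finset.in_set => ->.
      rewrite inE negb_or zN andbT; apply: contraTneq uz => ->; exact: adj_irr.
    - by rewrite adj_sym uz.
    - by move: sg; rewrite mulnS -[(size s).+2]addn2 !addnA.
  apply: le_trans (ler_wpM2l _ le1) _; first exact: weight_ge0.
  (* The recursion for [X] reduces the last factor to [1 - X u], which is at most 1. *)
  rewrite [leLHS](_ : _ = eps * ratio (W :\ v) u *
    (X u * (1 + t * \sum_(z | adj u z && (z != v)) X z) - X u)); last by ring.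
  rewrite Xu ler_piMr //; last by rewrite gerBl ltW.
  by rewrite mulr_ge0 // ltW.
rewrite (recursion_diff _ _ _ _ Rv Xv) normrM.
rewrite ger0_norm; last exact: weight_ge0.
rewrite -sumrB.
set S := \sum_(u | adj v u && (u != w)) ratio (W :\ v) u in Rv.
have le1 : `|\sum_(u | adj v u && (u != w)) (X u - ratio (W :\ v) u)| <= eps * S.
  rewrite big_distrr /=; apply: le_trans (ler_norm_sum _ _ _) _.
  by apply: ler_sum => u /andP[vu uw]; rewrite distrC step.
apply: le_trans (ler_wpM2l _ le1) _; first exact: weight_ge0.
(* Second step: the bound becomes [eps * X v * (1 - ratio W v)], and [ratio W v >= 1 / (1 + K)]
   yields the factor [K / (1 + K)]. *)
rewrite [leLHS](_ : _ = eps * X v * (ratio W v * (1 + t * S) - ratio W v)); last by ring.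
rewrite Rv exprSr mulrA -/eps -[leRHS]mulrA [_ / _ * _]mulrC mulrA.
apply: ler_wpM2l; first by rewrite mulr_ge0 // ltW.
rewrite ler_pdivlMr // mulrBl mul1r lerBlDr [leLHS]addrC lerD2l.
rewrite -[leLHS]Rv; apply: ler_wpM2l; first exact: ltW.
rewrite lerD2l; apply: ler_pM => //.
  by apply: sumr_ge0 => u _; exact/ltW.
have : \sum_(u | adj v u && (u \in W)) ratio (W :\ v) u <= D%:R.
  apply: (@le_trans _ _ (\sum_(u | adj v u) 1)).
    rewrite big_mkcondr; apply: ler_sum => u vu; case: ifP => // uW.
    apply: (avoid_ratio_le1 R G t) => //; rewrite !inE in uW *; rewrite uW andbT.
    by apply: contraTneq vu => ->; exact: adj_irr.
  by rewrite sumr_const ler_nat; exact: deg_le.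
apply: le_trans; rewrite le_eqVlt; apply/orP; left; apply/eqP.
by rewrite /S -eqS; apply: eq_bigl => u; rewrite andbC.
Qed.

(** At the root no neighbour has been deleted, hence the separate value [Q]. One more use of the
    recursion carries over the errors of the neighbours, each seen from the one-vertex path [v];
    they become absolute because [X <= 1]. *)
Lemma root_ratio_bound j (Q : R) v : (2 + 2 * j < g)%N -> 0 < Q <= 1 ->
  Q * (1 + t * \sum_(u | adj v u) X u) = 1 ->
  `|ratio [set: V]%SET v - Q| <= t * (D%:R * ((1 + K) * (K / (1 + K)) ^+ j)).
Proof.
move=> jg /andP[Q0 Q1] Qv; set eps := (1 + K) * _.
have K1 : 0 < 1 + K by rewrite ltr_pwDl.
have eps0 : 0 <= eps.
  by apply: mulr_ge0; [exact: ltW|rewrite exprn_ge0 // divr_ge0 // ltW].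
have vT : v \in [set: V]%SET by rewrite inE.
have Rv := avoid_ratio_rec R G t adj_sym adj_irr t_ge0 _ v vT.
have r1 := avoid_ratio_le1 R G t adj_sym adj_irr t_ge0 _ v vT.
have r0 := avoid_ratio_gt0 R G t t_ge0 [set: V]%SET v.
have eqS (F : V -> R) : \sum_(u in [set: V]%SET | adj v u) F u = \sum_(u | adj v u) F u.
  by apply: eq_bigl => u; rewrite inE.
rewrite eqS in Rv.
rewrite (recursion_diff _ _ _ _ Rv Qv) normrM.
rewrite ger0_norm; last exact: weight_ge0.
have le1 : `|\sum_(u | adj v u) X u - \sum_(u | adj v u) ratio ([set: V]%SET :\ v) u|
   <= D%:R * eps.
  rewrite -sumrB; apply: le_trans (ler_norm_sum _ _ _) _.
  apply: (@le_trans _ _ (\sum_(u | adj v u) eps)); last first.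
    by rewrite sumr_const -[leLHS]mulr_natl ler_wpM2r // ler_nat; exact: deg_le.
  apply: ler_sum => u vu; rewrite distrC.
  have -> : [set: V]%SET :\ v = (~: [set x in [:: v]])%SET.
    by apply/finset.setP => x; rewrite !inE andbT.
  apply: le_trans (cavity_contraction j u v [::] _ _ _) _ => //=.
  - by rewrite andbT inE; apply: contraTneq vu => ->; exact: adj_irr.
  - by rewrite adj_sym vu.
  - by rewrite -/eps ler_piMr.
rewrite -[t * _ * Q]mulrA -mulrA; apply: ler_wpM2l => //; apply: le_trans le1.
apply: ler_piMl => //.
by apply: mulr_ile1 => //; exact: ltW.
Qed.

End Cavity.

(** * Biregular graphs *)

Definition activity {R : realType} (a b gam : R) : R :=
  gam * (1 - gam) / ((1 - a * gam) * (1 - b * gam)).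

Section Biregular.
Variables (R : realType) (a b : nat).
Hypotheses (a_gt0 : (0 < a)%N) (b_gt0 : (0 < b)%N).

Lemma biregular_double_count (G : FinGraph) (A : {set 'I_(fg_n G)}) :
  (forall u v, fg_adj G u v = fg_adj G v u) ->
  (forall u v, fg_adj G u v -> (u \in A) != (v \in A)) ->
  (forall u, u \in A -> #|[set v | fg_adj G u v]%SET| = a) ->
  (forall u, u \notin A -> #|[set v | fg_adj G u v]%SET| = b) ->
  (#|A| * a = #|~: A| * b)%N.
Proof.
move=> adj_sym bip degA degB.
transitivity (\sum_(u in A) \sum_(v in ~: A | fg_adj G u v) 1)%N.
  rewrite -sum_nat_const; apply: eq_bigr => u uA.
  rewrite -(degA u uA) -sum1_card; apply: eq_bigl => v; rewrite !inE.
  by case uv : (fg_adj G u v); rewrite ?andbF // andbT; move: (bip _ _ uv); rewrite uA.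
rewrite (exchange_big_dep (fun v => v \in ~: A)) /=; last by move=> u v _ /andP[].
rewrite -sum_nat_const; apply: eq_bigr => v; rewrite finset.in_setC => vA.
rewrite -(degB v vA) -sum1_card; apply: eq_bigl => u; rewrite !inE vA /= adj_sym.
case uv : (fg_adj G v u); rewrite ?andbF // andbT.
by move: (bip _ _ uv); rewrite (negPf vA); case: (u \in A).
Qed.

(** On the tree a vertex of degree [c] is uncovered with probability [1 - c gam], and a given edge
    is unmatched with probability [1 - gam]; their quotient is the probability of being uncovered
    once that edge is deleted. The two identities are the cavity and the root recursion. *)
Lemma cavity_fixpoint (gam : R) (c d : nat) : (0 < c)%N -> (0 < d)%N -> 0 <= gam ->
  c%:R * gam < 1 -> d%:R * gam < 1 ->
  [/\ 0 < (1 - c%:R * gam) / (1 - gam) <= 1,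
      (1 - c%:R * gam) / (1 - gam)
      * (1 + activity c%:R d%:R gam * (c.-1%:R * ((1 - d%:R * gam) / (1 - gam)))) = 1
   & (1 - c%:R * gam)
      * (1 + activity c%:R d%:R gam * (c%:R * ((1 - d%:R * gam) / (1 - gam)))) = 1].
Proof.
case: c => // c _ d0 g0 cg dg.
have g1 : gam < 1 by apply: le_lt_trans cg; rewrite ler_peMl // ler1n.
have c0 : 0 <= c%:R * gam :> R by rewrite mulr_ge0.
rewrite -natr1 /= in cg *.
have n1 : 1 - gam != 0 by rewrite gt_eqF // subr_gt0.
have n2 : 1 - (c%:R + 1) * gam != 0 by rewrite gt_eqF // subr_gt0.
have n3 : 1 - d%:R * gam != 0 by rewrite gt_eqF // subr_gt0.
split.
- rewrite divr_gt0 ?subr_gt0 //= ler_pdivrMr ?subr_gt0 // mul1r.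
  by rewrite lerD2l lerN2 mulrDl mul1r lerDr.
- by rewrite /activity; field; rewrite n1 n2 n3.
- by rewrite /activity; field; rewrite n1 n2 n3.
Qed.

(** Averages [root_ratio_bound] over all vertices, with [a + b] as a crude degree bound. Keeping [T]
    apart from the activity makes the geometric factor uniform over all activities up to [T]. *)
Lemma biregular_pG_bound (G : FinGraph) (gam T : R) (g j : nat) :
  biregular a b G -> 0 <= gam -> a%:R * gam < 1 -> b%:R * gam < 1 ->
  activity a%:R b%:R gam <= T ->
  (forall s : seq 'I_(fg_n G), uniq s -> (3 <= size s)%N ->
     path.cycle (fg_adj G) s -> (g <= size s)%N) ->
  (2 + 2 * j < g)%N ->
  `|pG G (activity a%:R b%:R gam) - 2 * a%:R * b%:R / (a%:R + b%:R) * gam|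
  <= activity a%:R b%:R gam * ((a + b)%:R * ((1 + T * (a + b)%:R)
       * (T * (a + b)%:R / (1 + T * (a + b)%:R)) ^+ j)).
Proof.
move=> [n0 [adj_sym [adj_irr [A [bip [degA degB]]]]]] g0 ag bg tT girth jg.
set t := activity _ _ _.
have g1 : gam < 1 by apply: le_lt_trans ag; rewrite ler_peMl // ler1n.
have t0 : 0 <= t by rewrite divr_ge0 ?mulr_ge0 // subr_ge0 ltW.
have degE v : #|[pred u | fg_adj G v u]| = if v \in A then a else b.
  rewrite -(eq_card (A := [set u | fg_adj G v u]%SET)); last by move=> u; rewrite !inE.
  by case: ifP => [/degA|/negbT/degB].
have deg_le v : (#|[pred u | fg_adj G v u]| <= a + b)%N.
  by rewrite degE; case: ifP; rewrite ?leq_addr ?leq_addl.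
pose x : R := (1 - a%:R * gam) / (1 - gam); pose y : R := (1 - b%:R * gam) / (1 - gam).
have [/andP[x0 x1] xE QA] := cavity_fixpoint gam a b a_gt0 b_gt0 g0 ag bg.
have [/andP[y0 y1] yE QB] := cavity_fixpoint gam b a b_gt0 a_gt0 g0 bg ag.
rewrite -/x -/y in x0 x1 xE y0 y1 yE QA QB.
have tC : activity b%:R a%:R gam = t by rewrite /t /activity [X in _ / X]mulrC.
rewrite tC in yE QB; rewrite -/t in xE QA.
pose X v := if v \in A then x else y.
pose Q v : R := if v \in A then 1 - a%:R * gam else 1 - b%:R * gam.
have X0 v : 0 < X v by rewrite /X; case: ifP.
have X1 v : X v <= 1 by rewrite /X; case: ifP.
have nbX v u : fg_adj G v u -> X u = if v \in A then y else x.
  by rewrite /X => /bip; case: (v \in A); case: (u \in A).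
have sumX v : \sum_(u | fg_adj G v u) X u
    = (if v \in A then a else b)%:R * (if v \in A then y else x).
  rewrite (eq_bigr (fun _ => if v \in A then y else x)) => [|u]; last exact: nbX.
  by rewrite sumr_const degE mulr_natl.
have sumX' v w : fg_adj G v w -> \sum_(u | fg_adj G v u && (u != w)) X u
    = (if v \in A then a else b).-1%:R * (if v \in A then y else x).
  move=> vw; have := sumX v; rewrite (bigD1 w) //= (nbX _ _ vw) => h.
  apply: (addrI (if v \in A then y else x)); rewrite h.
  case: ifP => _; first by rewrite -{1}(prednK a_gt0) -natr1; ring.
  by rewrite -{1}(prednK b_gt0) -natr1; ring.
have Xrec v w : fg_adj G v w ->
    X v * (1 + t * \sum_(u | fg_adj G v u && (u != w)) X u) = 1.
  by move=> vw; rewrite (sumX' _ _ vw) /X; case: ifP.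
have Qrec v : Q v * (1 + t * \sum_(u | fg_adj G v u) X u) = 1.
  by rewrite sumX /Q; case: ifP.
have Q01 v : 0 < Q v <= 1.
  by rewrite /Q; case: ifP => _; rewrite subr_gt0 gerBl mulr_ge0 ?andbT.
have bound v := root_ratio_bound R G t T (a + b) g adj_sym adj_irr t0 tT deg_le girth
  X X0 X1 Xrec j (Q v) v jg (Q01 v) (Qrec v).
set E := _ * (_ * _) in bound *.
have nR : 0 < (fg_n G)%:R :> R by rewrite ltr0n.
have abR : (a%:R + b%:R : R) != 0 by rewrite -natrD pnatr_eq0 addn_eq0 negb_and -!lt0n a_gt0.
(* Double counting gives the class of degree [a] the proportion [b / (a + b)], and both classes
   contribute [a b gam / (a + b)] to the mean. *)
have -> : 2 * a%:R * b%:R / (a%:R + b%:R) * gam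
    = (fg_n G)%:R^-1 * \sum_v (1 - Q v).
  have -> : \sum_v (1 - Q v) = #|A|%:R * (a%:R * gam) + #|~: A|%:R * (b%:R * gam).
    rewrite (bigID (fun v => v \in A)) /= /Q; congr (_ + _).
      by rewrite [RHS]mulr_natl -sumr_const; apply: eq_bigr => v ->; rewrite subKr.
    rewrite [RHS]mulr_natl -sumr_const; apply: eq_big => v; first by rewrite inE.
    by move=> /negPf ->; rewrite subKr.
  have dc := biregular_double_count G A adj_sym bip degA degB.
  have /(congr1 (fun k : nat => k%:R : R)) := dc; rewrite !natrM => dcR.
  have := cardsC A; rewrite card_ord => nE.
  have /(congr1 (fun k : nat => k%:R : R)) := nE; rewrite natrD => nER.
  rewrite -nER; rewrite -nER in nR.
  move: (#|A|%:R : R) (#|~: A|%:R : R) dcR nR abR => p q dcR nR abR.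
  have pE : p = (p + q) * b%:R / (a%:R + b%:R).
    apply: (canRL (mulfK abR)); rewrite mulrDr dcR; ring.
  have qE : q * (a%:R + b%:R) = (p + q) * a%:R by rewrite mulrDr -dcR; ring.
  have -> : p * (a%:R * gam) + q * (b%:R * gam) = (p * a%:R + q * b%:R) * gam by ring.
  rewrite -dcR {2 3}pE; field.
  by rewrite abR gt_eqF.
rewrite pGE // -mulrBr -sumrB normrM ger0_norm; last by rewrite invr_ge0 ltW.
rewrite ler_pdivrMl //; apply: le_trans (ler_norm_sum _ _ _) _.
apply: (@le_trans _ _ (\sum_(v : 'I_(fg_n G)) E)).
  apply: ler_sum => v _; rewrite -/(avoid_ratio R G t _ v).
  have := bound v; set r := avoid_ratio _ _ _ _ _.
  by rewrite (_ : 1 - r - (1 - Q v) = - (r - Q v)) ?normrN //; ring.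
by rewrite sumr_const card_ord mulr_natl.
Qed.

End Biregular.

(** * Monotonicity of p(G, t) *)

Section Monotonicity.
Variables (R : realType) (G : FinGraph).
Hypothesis adj_irr : forall u, ~~ fg_adj G u u.

Lemma horner_matchpoly_gt0 (t : R) : 0 <= t -> 0 < (matchpoly R G).[t].
Proof.
by move=> t0; rewrite horner_matchpoly_matchsum //; exact: matchsum_gt0.
Qed.

Lemma horner_matchpoly_le (s t : R) : 0 <= s -> s <= t ->
  (matchpoly R G).[s] <= (matchpoly R G).[t].
Proof.
move=> s0 st; rewrite !horner_matchpoly //; apply: ler_sum => M _.
by rewrite lerXn2r // nnegrE // (le_trans s0).
Qed.

(** The exponent [k] and [(t / s) ^+ k] increase together; without the quotient, [s = 0] is
    allowed. *)
Lemma chebyshev_powers (k l : nat) (s t : R) : 0 <= s -> s <= t ->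
  0 <= (k%:R - l%:R) * (t ^+ k * s ^+ l - s ^+ k * t ^+ l).
Proof.
move=> s0 st; have t0 := le_trans s0 st.
wlog kl : k l / (l <= k)%N.
  by move=> h; have [/h //|/ltnW/h] := leqP l k; rewrite -mulrNN !opprB ![_ ^+ l * _]mulrC.
rewrite -(subnK kl) natrD addrK !exprD; apply: mulr_ge0 => //.
rewrite [X in X - _]mulrAC -!mulrA -mulrBl [s ^+ l * _]mulrC.
rewrite mulr_ge0 ?mulr_ge0 ?exprn_ge0 // subr_ge0 lerXn2r // nnegrE //.
Qed.

(** Up to a constant this is the mean matching size. Clearing denominators leaves a double sum over
    pairs of matchings, and symmetrizing it in the pair makes every term nonnegative by
    [chebyshev_powers]. *)
Lemma pG_le (s t : R) : 0 <= s -> s <= t -> pG G s <= pG G t.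
Proof.
move=> s0 st; have t0 := le_trans s0 st.
have Ms := horner_matchpoly_gt0 s s0; have Mt := horner_matchpoly_gt0 t t0.
have pGE' u : pG G u = 2 / (nverts G)%:R *
    (u * (matchpoly R G)^`().[u] / (matchpoly R G).[u]).
  by rewrite /pG invfM; ring.
rewrite !pGE'; apply: ler_wpM2l; first by rewrite divr_ge0.
rewrite ler_pdivrMr // mulrAC ler_pdivlMr //.
rewrite !horner_deriv_matchpoly // !horner_matchpoly // -subr_ge0.
set P := fun M : {set {set 'I_(fg_n G)}} => is_matching M.
pose f (M N : {set {set 'I_(fg_n G)}}) : R :=
  #|M|%:R * (t ^+ #|M| * s ^+ #|N| - s ^+ #|M| * t ^+ #|N|).
rewrite [X in 0 <= X](_ : _ = \sum_(M | P M) \sum_(N | P N) f M N); last first.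
  rewrite !big_distrlr /= -sumrB; apply: eq_bigr => M _.
  by rewrite -sumrB; apply: eq_bigr => N _; rewrite /f mulrBr !mulrA.
rewrite -(pmulr_rge0 _ (ltr0n R 2)) mulr_natl mulr2n.
rewrite {2}exchange_big /= -big_split /=; apply: sumr_ge0 => M _.
rewrite -big_split /=; apply: sumr_ge0 => N _.
have := chebyshev_powers #|M| #|N| s t s0 st.
by rewrite /f; move: #|M| #|N| => k l; rewrite mulrBl -[- (l%:R * _)]mulrN opprB ![_ ^+ l * _]mulrC.
Qed.

Lemma pG_le_pstar (t : R) : 0 <= t -> pG G t <= pstar R G.
Proof.
move=> t0; rewrite /pG /pstar -[2 * t * _]mulrA horner_deriv_matchpoly //.
have M0 := horner_matchpoly_gt0 t t0.
rewrite invfM mulrA ler_pdivrMr // [leRHS]mulrAC; apply: ler_wpM2r; first by rewrite invr_ge0.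
rewrite -mulrA; apply: ler_wpM2l => //; rewrite horner_matchpoly // big_distrr /=.
apply: ler_sum => M mM; apply: ler_wpM2r; first by rewrite exprn_ge0.
by rewrite ler_nat /numatch; exact: (@leq_bigmax_cond _ (@is_matching G) (fun M : {set {set 'I_(fg_n G)}} => #|M|) M mM).
Qed.

Lemma pG0 : pG G (0 : R) = 0.
Proof. by rewrite /pG mulr0 !mul0r. Qed.

Lemma continuous_pG (t : R) : (0 < nverts G)%N -> 0 <= t ->
  {for t, continuous (pG G)}.
Proof.
move=> n0 t0; rewrite /pG; apply: cvgM.
  apply: cvgM; last exact: continuous_horner.
  by apply: cvgM; [exact: cvg_cst|exact: cvg_id].
apply: cvgV; first by rewrite mulf_neq0 ?pnatr_eq0 -?lt0n // gt_eqF // horner_matchpoly_gt0.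
by apply: cvgM; [exact: cvg_cst|exact: continuous_horner].
Qed.

(** [tG] is a choice by [get], meaningful only once a solution exists; the intermediate value
    theorem on [[0, t]] supplies one. *)
Lemma tGP (p t : R) : (0 < nverts G)%N -> 0 <= p -> 0 <= t -> p <= pG G t ->
  0 <= tG G p /\ pG G (tG G p) = p.
Proof.
move=> n0 p0 t0 pt.
suff ex : exists u : R, 0 <= u /\ pG G u = p by exact: (getPex ex).
have cont : {within `[0, t], continuous (pG G : R -> R)}%classic.
  apply: continuous_in_subspaceT => u; rewrite inE /= in_itv /= => /andP[u0 _].
  exact: continuous_pG.
have [|u] := @IVT R (pG G) 0 t p t0 cont.
  apply/andP; split; last by rewrite le_max pt orbT.
  by rewrite ge_min pG0 p0.
by rewrite in_itv /= => /andP[u0 _] up; exists u.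
Qed.

Lemma pG_lt (s t : R) : 0 <= t -> pG G s < pG G t -> s < t.
Proof.
move=> t0 st; rewrite ltNge; apply/negP => ts.
by have := pG_le t s t0 ts; rewrite leNgt st.
Qed.

End Monotonicity.

(** * The Bethe free energy *)

(** The limit of [ln M / v] at activity [activity a b gam]. Per vertex of the graph there are
    [a b / (a + b)] edges, each contributing [ln (1 - gam)], and [b / (a + b)] vertices of degree
    [a], each contributing [- ln (1 - a gam)]; likewise for degree [b]. *)
Definition bethe {R : realType} (a b gam : R) : R :=
  a * b / (a + b) * ln (1 - gam) - a / (a + b) * ln (1 - b * gam)
  - b / (a + b) * ln (1 - a * gam).

Section Derivatives.
Variable R : realType.
Implicit Types a b c x gam : R.

Lemma is_derive_horner (p q : {poly R}) (f : R -> R) (x d : R) :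
  (forall y, f y = p.[y]) -> d = p^`().[x] -> is_derive x 1 f d.
Proof.
move=> fE ->; rewrite (_ : f = horner p); first exact: is_derive_poly.
exact/funext.
Qed.

Lemma is_derive_affine a x : is_derive x 1 (fun y => 1 - a * y) (- a).
Proof.
apply: (is_derive_horner (1 - a *: 'X) 0) => [y|]; first by rewrite !hornerE.
by rewrite derivB derivZ derivX -polyC1 derivC !hornerE.
Qed.

Lemma is_derive_ln_comp (f : R -> R) (x d : R) : 0 < f x ->
  is_derive x 1 f d -> is_derive x 1 (fun y => ln (f y)) (d / f x).
Proof.
move=> f0 df; rewrite mulrC.
exact: (@is_derive1_comp R (@ln R) f x _ _ (is_derive1_ln f0) df).
Qed.

Definition activity_deriv a b gam : R :=
  (1 - 2 * gam) / ((1 - a * gam) * (1 - b * gam))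
  + gam * (1 - gam) * (a * (1 - b * gam) + b * (1 - a * gam))
    / ((1 - a * gam) * (1 - b * gam)) ^+ 2.

Lemma is_derive_activity a b gam : 1 - a * gam != 0 -> 1 - b * gam != 0 ->
  is_derive gam 1 (activity a b) (activity_deriv a b gam).
Proof.
move=> a0 b0.
have num : is_derive gam 1 (fun y : R => y * (1 - y)) (1 - 2 * gam).
  apply: (is_derive_horner ('X * (1 - 'X)) 0) => [y|]; first by rewrite !hornerE.
  by rewrite derivM derivB derivX -polyC1 derivC !hornerE; ring.
have den : is_derive gam 1 (fun y : R => (1 - a * y) * (1 - b * y))
    (- (a * (1 - b * gam) + b * (1 - a * gam))).
  apply: (is_derive_eq (is_deriveM (is_derive_affine a gam) (is_derive_affine b gam))).
  by rewrite /GRing.scale /=; ring.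
have den0 : (1 - a * gam) * (1 - b * gam) != 0 by rewrite mulf_neq0.
pose D (y : R) := (1 - a * y) * (1 - b * y).
have inv := @is_deriveV R D gam _ 1 den0 den.
apply: (is_derive_eq (is_deriveM num inv)).
rewrite /activity_deriv /D /GRing.scale /=; field.
by rewrite a0 b0.
Qed.

Lemma activity_deriv_ge0 a b gam : 1 <= a -> 1 <= b -> 0 <= gam ->
  a * gam < 1 -> b * gam < 1 -> 0 <= activity_deriv a b gam.
Proof.
move=> a1 b1 g0 ag bg.
have g1 : gam <= 1 by apply: le_trans (ltW ag); rewrite ler_peMl.
have A0 : 0 < 1 - a * gam by rewrite subr_gt0.
have B0 : 0 < 1 - b * gam by rewrite subr_gt0.
rewrite /activity_deriv.
(* The negative part of [1 - 2 * gam] is absorbed through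
   [a * (1 - gam) - (1 - a * gam) = a - 1]. *)
rewrite [X in 0 <= X](_ : _ = ((1 - gam) * (1 - a * gam) * (1 - b * gam)
   + gam * (1 - b * gam) * (a - 1) + gam * (1 - gam) * (b * (1 - a * gam)))
   / ((1 - a * gam) * (1 - b * gam)) ^+ 2); last first.
  by field; rewrite !gt_eqF.
have G0 : 0 <= 1 - gam by rewrite subr_ge0.
have a10 : 0 <= a - 1 by rewrite subr_ge0.
have b0 : 0 <= b by rewrite (le_trans ler01).
have {}A0 := ltW A0; have {}B0 := ltW B0.
by rewrite divr_ge0 ?sqr_ge0 // !addr_ge0 // !mulr_ge0.
Qed.

Lemma activity_le a b gam gam' : 1 <= a -> 1 <= b -> 0 <= gam -> gam <= gam' ->
  a * gam' < 1 -> b * gam' < 1 -> activity a b gam <= activity a b gam'.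
Proof.
move=> a1 b1 g0 gg' ag bg.
have a0 : 0 <= a by rewrite (le_trans ler01).
have b0 : 0 <= b by rewrite (le_trans ler01).
have ag' x : x <= gam' -> a * x < 1 by move=> xg; rewrite (le_lt_trans _ ag) // ler_wpM2l.
have bg' x : x <= gam' -> b * x < 1 by move=> xg; rewrite (le_lt_trans _ bg) // ler_wpM2l.
have der x : x <= gam' -> is_derive x 1 (activity a b) (activity_deriv a b x).
  by move=> xg; apply: is_derive_activity; rewrite gt_eqF // subr_gt0 ?ag' ?bg'.
have [x|x|c cg E] := @MVT_segment R (activity a b) (activity_deriv a b) _ _ gg'.
- by rewrite in_itv /= => /andP[_ /ltW]; exact: der.
- apply: derivable_within_continuous => y; rewrite in_itv /= => /andP[_ yg].
  by case: (der y yg).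
move: cg; rewrite in_itv /= => /andP[gc cg'].
rewrite -subr_ge0 E mulr_ge0 ?subr_ge0 // activity_deriv_ge0 ?ag' ?bg' //.
exact: le_trans gc.
Qed.

(** This form includes [gam = 0], where the activity vanishes and cannot be divided by; it provides
    continuity up to that endpoint. *)
Lemma bethe_deriv a b gam : 0 < 1 - gam -> 0 < 1 - a * gam -> 0 < 1 - b * gam ->
  is_derive gam 1 (bethe a b) (a * b / (a + b) * (- 1 / (1 - gam))
    - a / (a + b) * (- b / (1 - b * gam)) - b / (a + b) * (- a / (1 - a * gam))).
Proof.
move=> G0 A0 B0.
have d1 : is_derive gam 1 (fun y => 1 - y : R) (- 1).
  apply: (is_derive_horner (1 - 'X) 0) => [y|]; first by rewrite !hornerE.
  by rewrite derivB derivX -polyC1 derivC !hornerE.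
have := is_derive_ln_comp (fun y => 1 - a * y) gam _ A0 (is_derive_affine a gam).
have := is_derive_ln_comp (fun y => 1 - b * y) gam _ B0 (is_derive_affine b gam).
have := is_derive_ln_comp (fun y => 1 - y) gam _ G0 d1.
move=> /(is_deriveZ (a * b / (a + b))) dG /(is_deriveZ (a / (a + b))) dB.
move=> /(is_deriveZ (b / (a + b))) dA.
exact: (is_deriveB (is_deriveB dG dB) dA).
Qed.

(* The derivative of [bethe] is [p / (2 t)] times that of the activity [t],
   where [p = 2 a b gam / (a + b)]. *)
Lemma is_derive_bethe a b gam : 0 < a -> 0 < b -> 0 < gam -> gam < 1 ->
  a * gam < 1 -> b * gam < 1 ->
  is_derive gam 1 (bethe a b)
    (a * b / (a + b) * gam / activity a b gam * activity_deriv a b gam).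
Proof.
move=> a0 b0 g0 g1 ag bg; rewrite -subr_gt0 in g1; rewrite -subr_gt0 in ag.
rewrite -subr_gt0 in bg.
apply: (is_derive_eq (bethe_deriv _ _ _ g1 ag bg)).
rewrite /activity /activity_deriv; field.
by rewrite !gt_eqF // addr_gt0.
Qed.

End Derivatives.

Lemma activity_ge0 (R : realType) (a b gam : R) : 1 <= a -> 0 <= gam ->
  a * gam < 1 -> b * gam < 1 -> 0 <= activity a b gam.
Proof.
move=> a1 g0 ag bg; have g1 : gam <= 1 by apply: le_trans (ltW ag); rewrite ler_peMl.
by rewrite divr_ge0 // mulr_ge0 // subr_ge0 // ltW.
Qed.

Lemma activity_gt0 (R : realType) (a b gam : R) : 1 <= a -> 0 < gam ->
  a * gam < 1 -> b * gam < 1 -> 0 < activity a b gam.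
Proof.
move=> a1 g0 ag bg; have g1 : gam < 1 by apply: le_lt_trans ag; rewrite ler_peMl // ltW.
by rewrite divr_gt0 // mulr_gt0 // subr_gt0.
Qed.

Lemma biregular_irr (a b : nat) (G : FinGraph) : biregular a b G ->
  forall u, ~~ fg_adj G u u.
Proof. by case=> _ [_ []]. Qed.

Lemma horner_matchpoly0 (R : realType) (G : FinGraph) : (matchpoly R G).[0] = 1.
Proof.
rewrite horner_coef0 coef_poly /= (_ : nmatch G 0 = 1%N) //.
rewrite /nmatch (_ : [set _ | _]%SET = [set finset.set0]%SET) ?cards1 //.
apply/finset.setP => M; rewrite !inE cards_eq0 andbC.
have [-> /=|//] := eqVneq M finset.set0.
by rewrite /is_matching finset.sub0set /=; apply/finset.trivIsetP => A B; rewrite inE.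
Qed.

(* Adding [+-C t / 2] makes the difference monotone in [gam], since its
   derivative is [t'] times an error controlled by [biregular_pG_bound]. *)
Lemma log_matchpoly_bound (R : realType) (a b : nat) (G : FinGraph)
    (gam : R) (g j : nat) :
  (0 < a)%N -> (0 < b)%N -> biregular a b G ->
  0 < gam -> a%:R * gam < 1 -> b%:R * gam < 1 ->
  (forall s : seq 'I_(fg_n G), uniq s -> (3 <= size s)%N ->
     path.cycle (fg_adj G) s -> (g <= size s)%N) ->
  (2 + 2 * j < g)%N ->
  forall T : R, T = activity a%:R b%:R gam ->
  `|ln (matchpoly R G).[T] / (nverts G)%:R - bethe a%:R b%:R gam|
  <= T * ((a + b)%:R * ((1 + T * (a + b)%:R)
       * (T * (a + b)%:R / (1 + T * (a + b)%:R)) ^+ j)) / 2.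
Proof.
move=> a_gt0 b_gt0 biG g0 ag bg girth jg T TE.
set C := (a + b)%:R * _.
have a1 : 1 <= a%:R :> R by rewrite ler1n.
have b1 : 1 <= b%:R :> R by rewrite ler1n.
have a0 : 0 < a%:R :> R by rewrite ltr0n.
have b0 : 0 < b%:R :> R by rewrite ltr0n.
have n0 : 0 < (nverts G)%:R :> R by rewrite ltr0n; case: biG.
have ag' (x : R) : x <= gam -> a%:R * x < 1.
  by move=> xg; rewrite (le_lt_trans _ ag) // ler_pM2l.
have bg' (x : R) : x <= gam -> b%:R * x < 1.
  by move=> xg; rewrite (le_lt_trans _ bg) // ler_pM2l.
have g1 (x : R) : x <= gam -> x < 1.
  move=> xg; apply: le_lt_trans xg (le_lt_trans _ ag).
  by rewrite ler_peMl // ltW.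
have act0 (x : R) : 0 <= x -> x <= gam -> 0 <= activity a%:R b%:R x.
  by move=> x0 xg; rewrite activity_ge0 ?ag' ?bg'.
have M0 (t : R) : 0 <= t -> 0 < (matchpoly R G).[t].
  exact: (horner_matchpoly_gt0 R G (biregular_irr _ _ _ biG)).
pose t := activity a%:R b%:R : R -> R; pose t' := activity_deriv R a%:R b%:R.
pose logM (x : R) := ln (matchpoly R G).[t x].
have dt x : 0 <= x -> x <= gam -> is_derive x 1 t (t' x).
  by move=> x0 xg; apply: is_derive_activity; rewrite gt_eqF // subr_gt0 ?ag' ?bg'.
have dlogM x : 0 <= x -> x <= gam -> is_derive x 1 logM
    ((matchpoly R G)^`().[t x] * t' x / (matchpoly R G).[t x]).
  move=> x0 xg; apply: (is_derive_ln_comp _ (fun x => (matchpoly R G).[t x]) x _ (M0 _ (act0 _ x0 xg))).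
  exact: (@is_derive1_comp R (horner (matchpoly R G)) t x _ _ (is_derive_poly _ _) (dt x x0 xg)).
pose F (s x : R) := (nverts G)%:R^-1 * logM x - bethe a%:R b%:R x + s * t x.
pose dF (s x : R) := t' x * ((matchpoly R G)^`().[t x] / ((nverts G)%:R * (matchpoly R G).[t x])
   - a%:R * b%:R / (a%:R + b%:R) * x / t x + s).
have F0 s : F s 0 = 0.
  rewrite /F /logM /t /activity /bethe !(mulr0, mul0r, subr0) horner_matchpoly0 ln1.
  by rewrite !(mulr0, subr0, addr0).
(* The mean value theorem replaces integration; its point is interior, so the activity there is
   positive. The slope [s] will be [C / 2] for the lower bound and [- (C / 2)] for the upper one. *)
have FMVT s : exists2 c, c \in `]0, gam[ & F s gam = dF s c * gam.
  have [x||c cg E] := @MVT R (F s) (dF s) 0 gam g0.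
  - rewrite in_itv /= => /andP[x0 /ltW xg].
    have := is_derive_bethe _ a%:R b%:R x a0 b0 x0 (g1 _ xg) (ag' _ xg) (bg' _ xg) => dB.
    have dL := dlogM x (ltW x0) xg; have dT := dt x (ltW x0) xg.
    apply: (is_derive_eq (is_deriveD (is_deriveB (is_deriveZ (nverts G)%:R^-1 dL) dB)
       (is_deriveZ s dT))).
    rewrite /dF /GRing.scale /= -/(t x) -/(t' x) [(_ * (matchpoly R G).[_])^-1]invfM; ring.
  - apply: derivable_within_continuous => x; rewrite in_itv /= => /andP[x0 xg].
    have dL := dlogM x x0 xg; have dT := dt x x0 xg.
    have A0 : 0 < 1 - a%:R * x by rewrite subr_gt0 ag'.
    have B0 : 0 < 1 - b%:R * x by rewrite subr_gt0 bg'.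
    have G0 : 0 < 1 - x by rewrite subr_gt0 g1.
    have dB := bethe_deriv R a%:R b%:R x G0 A0 B0.
    by case: (is_deriveD (is_deriveB (is_deriveZ (nverts G)%:R^-1 dL) dB)
       (is_deriveZ s dT)).
  - by exists c => //; move: E; rewrite F0 !subr0.
(* The bound on [p] carries a factor [t], which cancels in [p / (2 t)]; the error therefore stays
   bounded down to activity 0. *)
have err x : 0 < x -> x < gam -> `|(matchpoly R G)^`().[t x] /
    ((nverts G)%:R * (matchpoly R G).[t x])
    - a%:R * b%:R / (a%:R + b%:R) * x / t x| <= C / 2.
  move=> x0 /ltW xg.
  have t0 : 0 < t x by rewrite activity_gt0 ?ag' ?bg'.
  have tT : t x <= T by rewrite TE activity_le // ltW.
  have := biregular_pG_bound R a b a_gt0 b_gt0 G x T g j biG (ltW x0) (ag' _ xg)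
    (bg' _ xg) tT girth jg.
  rewrite -/(t x) -/C /pG.
  set m := (matchpoly R G)^`().[t x]; set M := _ * (matchpoly R G).[t x].
  have Mn : M != 0 by rewrite gt_eqF // mulr_gt0 // M0 // ltW.
  have abn : (a%:R + b%:R : R) != 0 by rewrite gt_eqF // addr_gt0.
  rewrite [X in `|X| <= _ -> _](_ : _ = (2 * t x) *
    (m / M - a%:R * b%:R / (a%:R + b%:R) * x / t x)); last first.
    by field; rewrite Mn abn gt_eqF.
  rewrite normrM gtr0_norm; last by rewrite mulr_gt0.
  move: (`|_|) (C) t0 => e c t0 h; rewrite -(ler_pM2l t0); lra.
have t'0 x : 0 < x -> x < gam -> 0 <= t' x.
  by move=> x0 /ltW xg; rewrite activity_deriv_ge0 ?ag' ?bg' // ltW.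
rewrite ler_norml; apply/andP; split.
- have [c] := FMVT (C / 2); rewrite in_itv /= => /andP[c0 cg] E.
  have : 0 <= F (C / 2) gam.
    rewrite E; apply: mulr_ge0; last exact: ltW.
    apply: mulr_ge0; first exact: t'0.
    by have := err c c0 cg; rewrite ler_norml => /andP[+ _]; rewrite -subr_ge0 opprK.
  rewrite /F /logM /t -TE => h; rewrite -subr_ge0.
  by apply: le_trans h _; rewrite le_eqVlt; apply/orP; left; apply/eqP; ring.
- have [c] := FMVT (- (C / 2)); rewrite in_itv /= => /andP[c0 cg] E.
  have : F (- (C / 2)) gam <= 0.
    rewrite E; apply: mulr_le0_ge0; last exact: ltW.
    apply: mulr_ge0_le0; first exact: t'0.
    by rewrite subr_le0; have := err c c0 cg; rewrite ler_norml => /andP[].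
  rewrite /F /logM /t -TE => h; rewrite -subr_le0.
  by apply: le_trans _ h; rewrite le_eqVlt; apply/orP; left; apply/eqP; ring.
Qed.

(** * Entropy and the edge density *)

Local Open Scope classical_set_scope.

Definition xlnx {R : realType} (x : R) : R := x * ln x.

(* The special values of [Hent] are redundant, as [ln 0 = 0]. *)
Lemma HentE (R : realType) (q : R) : Hent q = - (xlnx q + xlnx (1 - q)).
Proof.
rewrite /Hent /xlnx; case: eqVneq => [->|_]; first by rewrite mul0r subr0 ln1 mulr0 addr0 oppr0.
by case: eqVneq => [->|//]; rewrite subrr mul0r ln1 mulr0 addr0 oppr0.
Qed.

(** With [x = y ^+ 2], it comes from [- ln y < 1 / y]. It gives continuity at 0. *)
Lemma norm_xlnx_le (R : realType) (x : R) : x <= 1 -> `|xlnx x| <= 2 * Num.sqrt x.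
Proof.
move=> x1; have [x0|x0] := leP x 0.
  by rewrite /xlnx ln0 // mulr0 normr0 mulr_ge0 // sqrtr_ge0.
set y := Num.sqrt x; have y0 : 0 < y by rewrite sqrtr_gt0.
have xE : x = y ^+ 2 by rewrite sqr_sqrtr // ltW.
have lny : - ln y < y^-1 by rewrite -lnV // ln_sublinear // invr_gt0.
have lnx0 : ln x <= 0 by exact: ln_le0.
have lnxE : ln x = ln y *+ 2 by rewrite xE lnXn.
rewrite /xlnx normrM gtr0_norm // ler0_norm // lnxE.
rewrite [leLHS](_ : _ = 2 * y * (y * - ln y)); last by rewrite {1}xE; ring.
apply: ler_piMr; first by rewrite mulr_ge0 // ltW.
by have := lny; rewrite -(ltr_pM2l y0) mulfV ?gt_eqF // => /ltW.
Qed.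

Lemma continuous_xlnx (R : realType) : continuous (@xlnx R).
Proof.
move=> x; have [x0|x0|->] := ltgtP x 0.
- rewrite /continuous_at {2}/xlnx ln0 ?ltW // mulr0.
  apply: cvg_near_cst; near=> y; rewrite /xlnx ln0 ?mulr0 //.
  by rewrite ltW //; near: y; exact: lt_nbhsl.
- by apply: cvgM; [exact: cvg_id|exact: continuous_ln].
- rewrite /continuous_at {2}/xlnx mul0r; apply/cvgr0Pnorm_le => e e0.
  have c : (2 * Num.sqrt y : R) @[y --> (0 : R)] --> (0 : R).
    have sqrt0 := @sqrt_continuous R 0; rewrite /continuous_at sqrtr0 in sqrt0.
    by rewrite -[X in _ --> X](mulr0 2); apply: cvgM; [exact: cvg_cst|exact: sqrt0].
  have /cvgr0Pnorm_le/(_ e e0) c' := c.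
  near=> y; apply: (@le_trans _ _ (2 * Num.sqrt y)).
    by apply: norm_xlnx_le; apply: ltW; near: y; exact: lt_nbhsl.
  apply: le_trans (ler_norm _) _; near: y; exact: c'.
Unshelve. all: by end_near. Qed.

(** Since [ln] is 0 on nonpositive reals, continuity holds on the whole line. It settles [p = p0],
    where the larger of the two vertex arguments of the entropy reaches 1. *)
Lemma continuous_Hent (R : realType) : continuous (@Hent R).
Proof.
rewrite (_ : @Hent R = fun q => - (xlnx q + xlnx (1 - q))); last exact/funext/HentE.
move=> q; apply: cvgN; apply: cvgD; first exact: continuous_xlnx.
have c1 : (1 - y : R) @[y --> q] --> 1 - q by apply: cvgB; [exact: cvg_cst|exact: cvg_id].
exact: (cvg_comp _ _ c1 (continuous_xlnx R (1 - q))).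
Qed.

(** The threshold on [i] may depend on [j]: it is the index from which the girth allows [j]
    contractions. *)
Lemma geometric_bound_cvg (R : realType) (u : nat -> R) (l c k : R) : 0 <= k < 1 ->
  (forall j : nat, \forall i \near \oo, `|u i - l| <= c * k ^+ j) -> u @ \oo --> l.
Proof.
move=> /andP[k0 k1] H; apply/cvgrPdist_le => e e0.
have cv : c * k ^+ j @[j --> \oo] --> (0 : R).
  rewrite -[X in _ --> X](mulr0 c); apply: cvgM; first exact: cvg_cst.
  by apply: cvg_expr; rewrite ger0_norm.
have /cvgr0Pnorm_le/(_ e e0)/filter_ex[j hj] := cv.
near=> i; rewrite distrC; apply: le_trans (le_trans (ler_norm _) hj).
by near: i; exact: H.
Unshelve. all: by end_near. Qed.

(* The roots of [(a b t + 1) x^2 - ((a + b) t + 1) x + t], the equation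
   [activity a b x = t], are separated by [1 / a] and by [1 / b]; this is the
   smaller one. *)
Definition edge_density {R : realType} (a b t : R) : R :=
  ((a + b) * t + 1 -
    Num.sqrt (1 + (2 * a + 2 * b - 4) * t + (a - b) ^+ 2 * t ^+ 2))
  / (2 * a * b * t + 2).

Section EdgeDensity.
Variables (R : realType).

Lemma edge_densityC (a b t : R) : edge_density a b t = edge_density b a t.
Proof.
rewrite /edge_density; congr ((_ - Num.sqrt _) / _); ring.
Qed.

Lemma discr_ge0 (a b t : R) : 1 <= a -> 1 <= b -> 0 <= t ->
  0 <= 1 + (2 * a + 2 * b - 4) * t + (a - b) ^+ 2 * t ^+ 2.
Proof.
move=> a1 b1 t0; have c0 : 0 <= 2 * a + 2 * b - 4 by lra.
apply: addr_ge0; last by rewrite mulr_ge0 // sqr_ge0.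
by rewrite addr_ge0 // mulr_ge0.
Qed.

Lemma edge_density_lt (a b t : R) : 1 <= a -> 1 <= b -> 0 <= t ->
  a * edge_density a b t < 1.
Proof.
move=> a1 b1 t0; rewrite /edge_density.
have D0 := discr_ge0 a b t a1 b1 t0; set D := 1 + _ + _ in D0 *.
have s0 := sqrtr_ge0 D; have s2 := sqr_sqrtr D0.
set s := Num.sqrt D in s0 s2 *.
have abt : 0 <= a * b * t by rewrite !mulr_ge0 // ?(le_trans ler01).
have u0 : 0 < 2 * a * b * t + 2 by lra.
rewrite mulrA ltr_pdivrMr // mul1r.
(* The square of the right side exceeds that of the left by [4 * (a - 1) * (a * b * t + 1)]. For
   [a = 1] the squares agree, and strictness comes from the negative left side. *)
suff : a * (a - b) * t + a - 2 < a * s by lra.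
have [a1'|] := ltP 1 a; last first.
  move=> a1'; have -> : a = 1 by apply/eqP; rewrite eq_le a1'.
  have : 0 <= (b - 1) * t by rewrite mulr_ge0 // subr_ge0.
  lra.
have as0 : 0 <= a * s by rewrite mulr_ge0 // (le_trans ler01).
rewrite ltNge; apply/negP => h.
have : (a * s) ^+ 2 <= (a * (a - b) * t + a - 2) ^+ 2.
  by rewrite lerXn2r // nnegrE // (le_trans as0).
rewrite exprMn s2 -subr_ge0.
rewrite (_ : _ - _ = - (4 * (a - 1) * (a * b * t + 1))); last by rewrite /D; ring.
rewrite oppr_ge0 leNgt => /negP; apply.
by rewrite !mulr_gt0 ?subr_gt0 //; lra.
Qed.

Lemma edge_density_ge0 (a b t : R) : 1 <= a -> 1 <= b -> 0 <= t ->
  0 <= edge_density a b t.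
Proof.
move=> a1 b1 t0; rewrite /edge_density.
have abt : 0 <= a * b * t by rewrite !mulr_ge0 // ?(le_trans ler01).
have w0 : 0 <= (a + b) * t + 1.
  by rewrite addr_ge0 // mulr_ge0 // addr_ge0 // (le_trans ler01).
apply: divr_ge0; last by lra.
rewrite subr_ge0 -[leRHS](ger0_norm w0) -sqrtr_sqr ler_sqrt ?sqr_ge0 // -subr_ge0.
rewrite (_ : _ - _ = 4 * (t * (a * b * t + 1))); last by ring.
by rewrite !mulr_ge0 // addr_ge0.
Qed.

Lemma activity_edge_density (a b t : R) : 1 <= a -> 1 <= b -> 0 <= t ->
  activity a b (edge_density a b t) = t.
Proof.
move=> a1 b1 t0.
have A0 := edge_density_lt a b t a1 b1 t0.
have B0 := edge_density_lt b a t b1 a1 t0; rewrite edge_densityC in B0.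
have D0 := discr_ge0 a b t a1 b1 t0.
have s2 := sqr_sqrtr D0.
have abt : 0 <= a * b * t by rewrite !mulr_ge0 // ?(le_trans ler01).
have v0 : a * b * t + 1 != 0 by rewrite gt_eqF // ltr_wpDl.
set g := edge_density a b t in A0 B0 *.
have gE : Num.sqrt (1 + (2 * a + 2 * b - 4) * t + (a - b) ^+ 2 * t ^+ 2)
    = (a + b) * t + 1 - 2 * (a * b * t + 1) * g.
  have u0 : 2 * a * b * t + 2 != 0 by rewrite gt_eqF //; lra.
  by rewrite /g /edge_density; field.
rewrite gE in s2.
(* Squaring [gE] gives this equation multiplied by [4 * (a * b * t + 1)]. *)
have q : (a * b * t + 1) * g ^+ 2 - ((a + b) * t + 1) * g + t = 0.
  apply: (mulfI v0); rewrite mulr0; lra.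
rewrite /activity; apply: (canLR (mulfK _)); last by lra.
by rewrite mulf_neq0 // gt_eqF // subr_gt0.
Qed.

End EdgeDensity.

(** * Limits along graph sequences *)

(** Comparison is available only at parameters strictly above [g]; continuity of the limit [phi]
    lets them descend to [g]. *)
Lemma upper_squeeze (R : realType) (u : nat -> R) (f : nat -> R -> R) (phi : R -> R)
    (g gmax : R) : g < gmax -> {for g, continuous phi} ->
  (forall g', g < g' -> g' < gmax -> f i g' @[i --> \oo] --> phi g') ->
  (forall g', g < g' -> g' < gmax -> \forall i \near \oo, u i <= f i g') ->
  forall e, 0 < e -> \forall i \near \oo, u i <= phi g + e.
Proof.
move=> gm phic fphi uf e e0.
have e20 : 0 < e / 2 by rewrite divr_gt0.
have /cvg_at_right_filter/cvgrPdist_le/(_ _ e20) near_phi := phic.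
have [g' [[gg' gm'] pg']] : exists g', (g < g' /\ g' < gmax) /\ `|phi g - phi g'| <= e / 2.
  apply: (@filter_ex _ g^'+); near=> x; split; first split.
  - by near: x; exact: nbhs_right_gt.
  - by near: x; exact: nbhs_right_lt.
  - by near: x; exact: near_phi.
have /cvgrPdist_le/(_ _ e20) near_f := fphi g' gg' gm'.
near=> i; have ui : u i <= f i g' by near: i; exact: uf.
have fi : `|phi g' - f i g'| <= e / 2 by near: i; exact: near_f.
move: pg' fi; rewrite !ler_norml => /andP[h1 h2] /andP[h3 h4]; lra.
Unshelve. all: by end_near. Qed.

Lemma lower_squeeze (R : realType) (u : nat -> R) (f : nat -> R -> R) (phi : R -> R)
    (g gmin : R) : gmin < g -> {for g, continuous phi} ->
  (forall g', gmin < g' -> g' < g -> f i g' @[i --> \oo] --> phi g') ->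
  (forall g', gmin < g' -> g' < g -> \forall i \near \oo, f i g' <= u i) ->
  forall e, 0 < e -> \forall i \near \oo, phi g - e <= u i.
Proof.
move=> gm phic fphi uf e e0.
have e20 : 0 < e / 2 by rewrite divr_gt0.
have /cvg_at_left_filter/cvgrPdist_le/(_ _ e20) near_phi := phic.
have [g' [[gg' gm'] pg']] : exists g', (gmin < g' /\ g' < g) /\ `|phi g - phi g'| <= e / 2.
  apply: (@filter_ex _ g^'-); near=> x; split; first split.
  - by near: x; exact: nbhs_left_gt.
  - by near: x; exact: nbhs_left_lt.
  - by near: x; exact: near_phi.
have /cvgrPdist_le/(_ _ e20) near_f := fphi g' gg' gm'.
near=> i; have ui : f i g' <= u i by near: i; exact: uf.
have fi : `|phi g' - f i g'| <= e / 2 by near: i; exact: near_f.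
move: pg' fi; rewrite !ler_norml => /andP[h1 h2] /andP[h3 h4]; lra.
Unshelve. all: by end_near. Qed.

Lemma cvg_between (R : realType) (u : nat -> R) (l : R) :
  (forall e, 0 < e -> \forall i \near \oo, u i <= l + e) ->
  (forall e, 0 < e -> \forall i \near \oo, l - e <= u i) -> u i @[i --> \oo] --> l.
Proof.
move=> up low; apply/cvgrPdist_le => e e0; near=> i.
have h1 : u i <= l + e by near: i; exact: up.
have h2 : l - e <= u i by near: i; exact: low.
by rewrite ler_norml; apply/andP; split; lra.
Unshelve. all: by end_near. Qed.

Section Sequences.
Variables (R : realType) (a b : nat) (G : nat -> FinGraph).
Hypotheses (a_gt0 : (0 < a)%N) (b_gt0 : (0 < b)%N).
Hypothesis biG : forall i, biregular a b (G i).
Hypothesis girthG : girth_to_infty G.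

Local Notation ra := (a%:R : R).
Local Notation rb := (b%:R : R).
Local Notation act := (@activity R a%:R b%:R).
(** The edge probability at which vertices of the larger degree would be covered with probability 1;
    it corresponds to [p0]. *)
Local Notation gmax := ((Num.max ra rb)^-1).

Lemma lt_gmax (gam : R) : 0 <= gam -> gam < gmax -> ra * gam < 1 /\ rb * gam < 1.
Proof.
move=> g0; have m0 : 0 < Num.max ra rb by rewrite lt_max ltr0n a_gt0.
rewrite -[gmax]mul1r ltr_pdivlMr // mulrC => h.
by split; apply: le_lt_trans h; apply: ler_wpM2r; rewrite // le_max lexx ?orbT.
Qed.

Lemma near_girth (j : nat) : \forall i \near \oo, forall s : seq 'I_(fg_n (G i)),
  uniq s -> (3 <= size s)%N -> path.cycle (fg_adj (G i)) s -> (2 + 2 * j < size s)%N.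
Proof. by have [N hN] := girthG (2 + 2 * j).+1; exists N. Qed.

Let ra1 : 1 <= ra. Proof. by rewrite ler1n. Qed.
Let rb1 : 1 <= rb. Proof. by rewrite ler1n. Qed.
Let D0 : 0 <= (a + b)%:R :> R. Proof. exact: ler0n. Qed.

Lemma contraction_ratio (K : R) : 0 <= K -> 0 <= K / (1 + K) < 1.
Proof.
move=> K0; have K1 : 0 < 1 + K by rewrite ltr_pwDl.
by rewrite divr_ge0 ?(ltW K1) //= ltr_pdivrMr // mul1r ltrDr.
Qed.

Lemma pG_activity_cvg (gam : R) : 0 <= gam -> gam < gmax ->
  pG (G i) (act gam) @[i --> \oo] --> 2 * ra * rb / (ra + rb) * gam.
Proof.
move=> g0 gm; have [ag bg] := lt_gmax gam g0 gm.
have T0 : 0 <= act gam by exact: activity_ge0.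
apply: (geometric_bound_cvg _ _ _ (act gam * ((a + b)%:R * (1 + act gam * (a + b)%:R)))
  _ (contraction_ratio (act gam * (a + b)%:R) (mulr_ge0 T0 D0))) => j.
have := near_girth j; apply: filterS => i girth.
have := biregular_pG_bound R a b a_gt0 b_gt0 (G i) gam (act gam) _ j (biG i) g0 ag bg
  (lexx _) girth (ltnSn _).
by rewrite !mulrA.
Qed.

Lemma log_matchpoly_cvg (gam : R) : 0 < gam -> gam < gmax ->
  ln (matchpoly R (G i)).[act gam] / (nverts (G i))%:R @[i --> \oo] --> bethe ra rb gam.
Proof.
move=> g0 gm; have [ag bg] := lt_gmax gam (ltW g0) gm.
have T0 : 0 <= act gam by rewrite activity_ge0 // ltW.
apply: (geometric_bound_cvg _ _ _ (act gam / 2 * ((a + b)%:R * (1 + act gam * (a + b)%:R)))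
  _ (contraction_ratio (act gam * (a + b)%:R) (mulr_ge0 T0 D0))) => j.
have := near_girth j; apply: filterS => i girth.
have := log_matchpoly_bound R a b (G i) gam _ j a_gt0 b_gt0 (biG i) g0 ag bg
  girth (ltnSn _) _ erefl.
by rewrite [_ / 2]mulrAC !mulrA.
Qed.

Let irr i : forall u, ~~ fg_adj (G i) u u := biregular_irr _ _ _ (biG i).

Let c0 : 0 < 2 * ra * rb / (ra + rb).
Proof. by rewrite divr_gt0 ?addr_gt0 ?mulr_gt0 ?ltr0n. Qed.

(** Eventually [pG] at the activity of [gam'] exceeds [p], since its limit does. This makes [tG] a
    genuine inverse value, bounds it by monotonicity, and puts [p] below [pstar], in the main branch
    of [lamG]. *)
Lemma tG_above (gam gam' : R) : 0 <= gam -> gam < gam' -> gam' < gmax ->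
  let p := 2 * ra * rb / (ra + rb) * gam in
  \forall i \near \oo, [/\ 0 <= tG (G i) p, pG (G i) (tG (G i) p) = p,
    p < pstar R (G i) & tG (G i) p <= act gam'].
Proof.
move=> g0 gg' gm' p; have g'0 := le_trans g0 (ltW gg').
have [ag bg] := lt_gmax gam' g'0 gm'.
have t'0 : 0 <= act gam' by exact: activity_ge0.
have p0 : 0 <= p by rewrite mulr_ge0 // ltW.
have pp' : p < 2 * ra * rb / (ra + rb) * gam' by rewrite ltr_pM2l.
have /cvgr_gt/(_ _ pp') := pG_activity_cvg gam' g'0 gm'; apply: filterS => i pi.
have n0 : (0 < nverts (G i))%N by case: (biG i).
have [t0 pt] := tGP R (G i) (irr i) p (act gam') n0 p0 t'0 (ltW pi).
split => //; first exact: lt_le_trans pi (pG_le_pstar R (G i) (irr i) _ t'0).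
by apply/ltW/(pG_lt R (G i) (irr i)); rewrite // pt.
Qed.

Lemma tG_below (gam gam' : R) : 0 <= gam' -> gam' < gam -> gam < gmax ->
  let p := 2 * ra * rb / (ra + rb) * gam in
  \forall i \near \oo, act gam' <= tG (G i) p.
Proof.
move=> g'0 gg' gm p; have g0 := le_trans g'0 (ltW gg').
have pp' : 2 * ra * rb / (ra + rb) * gam' < p by rewrite ltr_pM2l.
(* Any parameter between [gam] and [gmax] would do: it only ensures that [tG] solves its
   equation. *)
have gmid : gam < (gam + gmax) / 2 < gmax by rewrite !midf_lt.
case/andP: gmid => gm1 gm2.
near=> i.
have [t0 pt _ _] : [/\ 0 <= tG (G i) p, pG (G i) (tG (G i) p) = p,
    p < pstar R (G i) & tG (G i) p <= act ((gam + gmax) / 2)].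
  by near: i; exact: tG_above.
apply/ltW/(pG_lt R (G i) (irr i)) => //; rewrite pt; near: i.
by have /cvgr_lt/(_ _ pp') := pG_activity_cvg gam' g'0 (lt_trans gg' gm).
Unshelve. all: by end_near. Qed.

Lemma continuous_activity (gam : R) : 0 <= gam -> gam < gmax -> {for gam, continuous act}.
Proof.
move=> g0 gm; have [ag bg] := lt_gmax gam g0 gm.
have [d _] : is_derive gam 1 act (activity_deriv R ra rb gam).
  by apply: is_derive_activity; rewrite gt_eqF // subr_gt0.
by apply: differentiable_continuous; exact/derivable1_diffP.
Qed.

Lemma continuous_bethe (gam : R) : 0 <= gam -> gam < gmax ->
  {for gam, continuous (bethe ra rb)}.
Proof.
move=> g0 gm; have [ag bg] := lt_gmax gam g0 gm.
have g1 : gam < 1 by apply: le_lt_trans ag; rewrite ler_peMl.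
rewrite -subr_gt0 in ag; rewrite -subr_gt0 in bg; rewrite -subr_gt0 in g1.
have [d _] := bethe_deriv R ra rb gam g1 ag bg.
by apply: differentiable_continuous; exact/derivable1_diffP.
Qed.

Lemma tG_cvg (gam : R) : 0 <= gam -> gam < gmax ->
  tG (G i) (2 * ra * rb / (ra + rb) * gam) @[i --> \oo] --> act gam.
Proof.
move=> g0 gm; have actc := continuous_activity gam g0 gm.
apply: cvg_between => e e0.
  apply: (upper_squeeze _ _ (fun _ => act) _ _ _ gm actc) => // g' gg' gm'.
    exact: cvg_cst.
  by have := tG_above gam g' g0 gg' gm'; apply: filterS => i [].
have [g00|g00] := ltP 0 gam.
  apply: (lower_squeeze _ _ (fun _ => act) _ _ 0 g00 actc) => // g' gg' gm'.
    exact: cvg_cst.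
  by apply: tG_below => //; exact: ltW.
(* At 0 there is no smaller parameter to compare with; nonnegativity of [tG] is the lower bound. *)
have gE : gam = 0 by apply/eqP; rewrite eq_le g00.
have [g' /andP[gg' gm']] : exists g', gam < g' < gmax.
  by exists ((gam + gmax) / 2); rewrite !midf_lt.
have := tG_above gam g' g0 gg' gm'; apply: filterS => i [t0 _ _ _].
by apply: le_trans t0; rewrite gE /activity !mul0r sub0r oppr_le0 ltW.
Qed.

(** The argument [tG] varies with [i], but the matching polynomial is monotone, so fixed activities
    on either side of the limit enclose it. *)
Lemma log_matchpoly_tG_cvg (gam : R) : 0 < gam -> gam < gmax ->
  ln (matchpoly R (G i)).[tG (G i) (2 * ra * rb / (ra + rb) * gam)]
    / (nverts (G i))%:R @[i --> \oo] --> bethe ra rb gam.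
Proof.
move=> g0 gm; have bc := continuous_bethe gam (ltW g0) gm.
have n0 i : 0 < (nverts (G i))%:R^-1 :> R by rewrite invr_gt0 ltr0n; case: (biG i).
have lnM_le i s t : 0 <= s -> s <= t ->
    ln (matchpoly R (G i)).[s] / (nverts (G i))%:R
    <= ln (matchpoly R (G i)).[t] / (nverts (G i))%:R.
  move=> s0 st; rewrite ler_pM2r // ler_ln ?posrE.
  - exact: horner_matchpoly_le.
  - exact: horner_matchpoly_gt0.
  - by apply: horner_matchpoly_gt0 => //; exact: le_trans st.
pose f i g' := ln (matchpoly R (G i)).[act g'] / (nverts (G i))%:R.
apply: cvg_between => e e0.
  apply: (upper_squeeze _ _ f _ _ _ gm bc) => // g' gg' gm'.
    by apply: log_matchpoly_cvg => //; exact: lt_trans gg'.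
  have := tG_above gam g' (ltW g0) gg' gm'; apply: filterS => i [t0 _ _ tt'].
  exact: lnM_le.
apply: (lower_squeeze _ _ f _ _ 0 g0 bc) => // g' gg' gm'.
  by apply: log_matchpoly_cvg => //; exact: lt_trans gm.
have := tG_below gam g' (ltW gg') gm' gm; apply: filterS => i tt'.
apply: lnM_le => //; have [ag bg] := lt_gmax g' (ltW gg') (lt_trans gm' gm).
by apply: activity_ge0 => //; exact: ltW.
Qed.

Lemma lamG_cvg (gam : R) : 0 < gam -> gam < gmax ->
  let p := 2 * ra * rb / (ra + rb) * gam in
  lamG (G i) p @[i --> \oo] --> bethe ra rb gam - 2^-1 * p * ln (act gam).
Proof.
move=> g0 gm p; have p0 : 0 < p by rewrite mulr_gt0.
have [g' /andP[gg' gm']] : exists g', gam < g' < gmax.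
  by exists ((gam + gmax) / 2); rewrite !midf_lt.
have [ag bg] := lt_gmax gam (ltW g0) gm.
have t0 : 0 < act gam by exact: activity_gt0.
have cvL : ln (matchpoly R (G i)).[tG (G i) p] / (nverts (G i))%:R
    - 2^-1 * p * ln (tG (G i) p) @[i --> \oo] --> bethe ra rb gam - 2^-1 * p * ln (act gam).
  apply: cvgB; first exact: log_matchpoly_tG_cvg.
  apply: cvgM; first exact: cvg_cst.
  exact: (cvg_comp _ _ (tG_cvg gam (ltW g0) gm) (continuous_ln t0)).
apply: cvg_trans cvL; apply: near_eq_cvg.
have := tG_above gam g' (ltW g0) gg' gm'; apply: filterS => i [_ _ ps _].
by rewrite /lamG (ltW p0) ps /lam0 gt_eqF.
Qed.

Lemma lamG0_cvg : lamG (G i) 0 @[i --> \oo] --> (0 : R).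
Proof.
have gm0 : 0 < gmax by rewrite invr_gt0 lt_max ltr0n a_gt0.
have [g' /andP[gg' gm']] : exists g', 0 < g' < gmax.
  by exists ((0 + gmax) / 2); rewrite !midf_lt.
apply: cvg_near_cst; have := tG_above 0 g' (lexx _) gg' gm'; rewrite mulr0.
by apply: filterS => i [_ _ ps _]; rewrite /lamG lexx ps /lam0 eqxx.
Qed.

End Sequences.

(** * Entropy form of the limit and conclusion *)

Definition entropy_density {R : realType} (a b p : R) : R :=
  a / (a + b) * Hent ((a + b) / (2 * a) * p)
  + b / (a + b) * Hent ((a + b) / (2 * b) * p)
  + 2^-1 * p * ln (a * b)
  - a * b / (a + b) * Hent ((a + b) / (2 * a * b) * p).

Lemma continuous_entropy_density (R : realType) (a b : R) :
  continuous (entropy_density a b).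
Proof.
have H c d : continuous (fun p : R => c * Hent (d * p) : R).
  move=> p; apply: cvgM; first exact: cvg_cst.
  have dp : (d * q : R) @[q --> p] --> d * p.
    by apply: cvgM; [exact: cvg_cst|exact: cvg_id].
  exact: (cvg_comp _ _ dp (continuous_Hent R (d * p))).
move=> p; apply: cvgB; last exact: H.
apply: cvgD; first by apply: cvgD; exact: H.
apply: cvgM; last exact: cvg_cst.
by apply: cvgM; [exact: cvg_cst|exact: cvg_id].
Qed.

Lemma entropy_density0 (R : realType) (a b : R) : entropy_density a b 0 = 0.
Proof. by rewrite /entropy_density /Hent !mulr0 eqxx !(mulr0, mul0r, addr0, subr0). Qed.

(** The three arguments of the entropy are [b gam], [a gam] and [gam]; expanding the logarithm of
    the activity leaves an identity linear in the logarithms. *)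
Lemma bethe_entropy (R : realType) (a b gam : R) : 0 < a -> 0 < b -> 0 < gam ->
  gam < 1 -> a * gam < 1 -> b * gam < 1 ->
  let p := 2 * a * b / (a + b) * gam in
  bethe a b gam - 2^-1 * p * ln (activity a b gam) = entropy_density a b p.
Proof.
move=> a0 b0 g0 g1 ag bg p; rewrite /entropy_density.
have ab0 : 0 < a + b by exact: addr_gt0.
have an : a != 0 by rewrite gt_eqF.
have bn : b != 0 by rewrite gt_eqF.
have abn : a + b != 0 by rewrite gt_eqF.
have -> : (a + b) / (2 * a) * p = b * gam by rewrite /p; field; rewrite an abn.
have -> : (a + b) / (2 * b) * p = a * gam by rewrite /p; field; rewrite bn abn.
have -> : (a + b) / (2 * a * b) * p = gam by rewrite /p; field; rewrite an bn abn.
have A0 : 0 < 1 - a * gam by rewrite subr_gt0.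
have B0 : 0 < 1 - b * gam by rewrite subr_gt0.
have G0 : 0 < 1 - gam by rewrite subr_gt0.
rewrite !HentE /xlnx /bethe /activity /p.
rewrite ln_div ?posrE ?mulr_gt0 // !lnM ?posrE ?mulr_gt0 //.
by field.
Qed.

Theorem theorem2p16 (R : realType) (a b : nat) (G : nat -> FinGraph) :
  (0 < a)%N -> (0 < b)%N ->
  (forall i, biregular a b (G i)) -> girth_to_infty G ->
  let ra : R := a%:R in let rb : R := b%:R in
  let p0 : R := Num.min (2 * ra / (ra + rb)) (2 * rb / (ra + rb)) in
  let lamT : R -> R := fun p => ra / (ra + rb) * Hent ((ra + rb) / (2 * ra) * p)
      + rb / (ra + rb) * Hent ((ra + rb) / (2 * rb) * p)
      + 2^-1 * p * ln (ra * rb)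
      - ra * rb / (ra + rb) * Hent ((ra + rb) / (2 * ra * rb) * p) in
  (* (a) *)
  (forall t : R, 0 <= t ->
     pG (G i) t @[i --> \oo] -->
       (2 * ra * rb * t + 2 * ra * rb / (ra + rb)
        - 2 * ra * rb / (ra + rb)
          * Num.sqrt (1 + (2 * ra + 2 * rb - 4) * t + (ra - rb) ^+ 2 * t ^+ 2))
       / (2 * ra * rb * t + 2)) /\
  (* (b) *)
  (forall p : R, 0 <= p < p0 ->
     tG (G i) p @[i --> \oo] -->
       (ra + rb) / (2 * ra * rb)
       * (p * (1 - (ra + rb) / (2 * ra * rb) * p))
       / ((1 - (ra + rb) / (2 * ra) * p) * (1 - (ra + rb) / (2 * rb) * p))) /\
  (* (c), 0 <= p < p0 *)
  (forall p : R, 0 <= p < p0 -> lamG (G i) p @[i --> \oo] --> lamT p) /\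
  (* (c), p = p0 : lambda_T(p0) := lim_{p -> p0^-} lambda_T(p) equals lamT p0 *)
  (lim (lamG (G i) p @[i --> \oo]) @[p --> p0^'-] --> lamT p0).
Proof.
move=> a_gt0 b_gt0 biG girthG ra rb p0 lamT.
have ra0 : 0 < ra by rewrite ltr0n.
have rb0 : 0 < rb by rewrite ltr0n.
have ra1 : 1 <= ra by rewrite ler1n.
have rb1 : 1 <= rb by rewrite ler1n.
have an : ra != 0 by rewrite gt_eqF.
have bn : rb != 0 by rewrite gt_eqF.
have abn : ra + rb != 0 by rewrite gt_eqF // addr_gt0.
have m0 : 0 < Num.max ra rb by rewrite lt_max ra0.
have lt_gmax' gam : ra * gam < 1 -> rb * gam < 1 -> gam < (Num.max ra rb)^-1.
  move=> ag bg; rewrite -[X in _ < X]mul1r ltr_pdivlMr // mulrC.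
  by rewrite maxEle; case: ifP.
pose gam p : R := (ra + rb) / (2 * ra * rb) * p.
have gamK p : 2 * ra * rb / (ra + rb) * gam p = p.
  by rewrite /gam; field; rewrite an bn abn.
have gam_ge0 p : 0 <= p -> 0 <= gam p.
  by move=> pge; rewrite mulr_ge0 // divr_ge0 ?mulr_ge0 ?addr_ge0 // ltW.
(* The two terms of the minimum [p0] say that neither class is covered with probability 1. *)
have gam_lt p : p < p0 -> [/\ ra * gam p < 1, rb * gam p < 1 & gam p < (Num.max ra rb)^-1].
  rewrite lt_min => /andP[pa pb].
  have ag : ra * gam p < 1.
    rewrite (_ : ra * gam p = p / (2 * rb / (ra + rb))).
      by rewrite ltr_pdivrMr ?mul1r // divr_gt0 ?mulr_gt0 ?addr_gt0.
    by rewrite /gam; field; rewrite an bn abn.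
  have bg : rb * gam p < 1.
    rewrite (_ : rb * gam p = p / (2 * ra / (ra + rb))).
      by rewrite ltr_pdivrMr ?mul1r // divr_gt0 ?mulr_gt0 ?addr_gt0.
    by rewrite /gam; field; rewrite an bn abn.
  by split => //; exact: lt_gmax'.
have lam_cvg p : 0 <= p < p0 -> lamG (G i) p @[i --> \oo] --> lamT p.
  case/andP; rewrite le_eqVlt => /predU1P[<- _|pgt plt].
    rewrite -/(entropy_density ra rb 0) /lamT -/(entropy_density ra rb 0).
    rewrite entropy_density0.
    exact: (lamG0_cvg R a b G a_gt0 b_gt0 biG girthG).
  have [ag bg gm] := gam_lt p plt.
  have g0 : 0 < gam p by rewrite mulr_gt0 // divr_gt0 ?mulr_gt0 ?addr_gt0.
  have g1 : gam p < 1 by apply: le_lt_trans ag; rewrite ler_peMl // ltW.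
  have := lamG_cvg R a b G a_gt0 b_gt0 biG girthG (gam p) g0 gm.
  by rewrite /= bethe_entropy // gamK.
split; [|split; [|split => //]].
(* For (a), [t] is the activity of [edge_density ra rb t], and multiplying that root by
   [2 a b / (a + b)] gives the stated formula. *)
- move=> t t0; have ag := edge_density_lt R ra rb t ra1 rb1 t0.
  have bg := edge_density_lt R rb ra t rb1 ra1 t0; rewrite edge_densityC in bg.
  have g0 := edge_density_ge0 R ra rb t ra1 rb1 t0.
  have := pG_activity_cvg R a b G a_gt0 b_gt0 biG girthG _ g0 (lt_gmax' _ ag bg).
  rewrite activity_edge_density //.
  have abt : 0 <= ra * rb * t by rewrite !mulr_ge0 // ltW.
  have u0 : 2 * ra * rb * t + 2 != 0 by rewrite gt_eqF //; lra.
  rewrite [X in _ --> X](_ : _ = (2 * ra * rb * t + 2 * ra * rb / (ra + rb)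
        - 2 * ra * rb / (ra + rb)
          * Num.sqrt (1 + (2 * ra + 2 * rb - 4) * t + (ra - rb) ^+ 2 * t ^+ 2))
       / (2 * ra * rb * t + 2)) //.
  by rewrite /edge_density; field; rewrite abn u0.
- move=> p /andP[pge plt]; have [ag bg gm] := gam_lt p plt.
  have := tG_cvg R a b G a_gt0 b_gt0 biG girthG (gam p) (gam_ge0 p pge) gm.
  rewrite gamK; rewrite [X in _ --> X -> _](_ : _ = (ra + rb) / (2 * ra * rb)
       * (p * (1 - (ra + rb) / (2 * ra * rb) * p))
       / ((1 - (ra + rb) / (2 * ra) * p) * (1 - (ra + rb) / (2 * rb) * p))) //.
  have eA : ra * gam p = (ra + rb) / (2 * rb) * p by rewrite /gam; field; rewrite an bn.
  have eB : rb * gam p = (ra + rb) / (2 * ra) * p by rewrite /gam; field; rewrite an bn.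
  by rewrite /activity -/ra -/rb eA eB [X in _ / X]mulrC /gam mulrA.
- have p0gt : 0 < p0 by rewrite lt_min !divr_gt0 ?mulr_gt0 ?addr_gt0.
  (* Just left of [p0] the inner limit equals [lamT p], so continuity of the closed formula
     suffices. *)
  have cl : lamT p @[p --> p0^'-] --> lamT p0.
    exact/cvg_at_left_filter/(continuous_entropy_density R ra rb).
  apply: cvg_trans cl; apply: near_eq_cvg; near=> p.
  apply/esym/cvg_lim => //; apply: lam_cvg; apply/andP; split.
    by apply: ltW; near: p; exact: nbhs_left_gt.
  by near: p; exact: nbhs_left_lt.
Unshelve. all: by end_near. Qed.
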